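(* Let $q$ be a power of an odd prime and let $G$ be the group of order $q^4$ and $D_1,D_2,\dots,D_{q+3}\subset G$ the subsets defined in the context. Then each $D_i$, $1\le i\le q+3$, is a partial difference set of Latin square type in $G$. Consequently, $\{D_i:1\le i\le q+3\}$ corresponds to a $(q+3)$-class amorphic association scheme on $G$, and a union of any number of these partial difference sets is also a partial difference set of Latin square type in $G$.
   Context: Partial difference sets. A $(v,k,\lambda,\mu)$-partial difference set (PDS) in a finite group $G$ of order $v$ is a subset $D$ with $|D|=k$ such that every nonidentity element of $D$ can be written as $d_1d_2^{-1}$ with $d_1,d_2\in D$ in exactly $\lambda$ ways, and every nonidentity element of $G-D$ in exactly $\mu$ ways. PDSs are assumed regular: $1_G\notin D$ and $D=D^{-1}$. A PDS is of Latin square type if its parameters are $(n^2,r(n-1),n+r^2-3r,r^2-r)$ for some natural number $r$. Association schemes. An association scheme with $t$ classes on a finite set $\mathcal{X}$ is a partition of $\mathcal{X}\times\mathcal{X}$ into relations $R_0,\dots,R_t$ such that $R_0$ is the diagonal, the transpose of each $R_\ell$ is some $R_{\ell'}$, and for all $i,j,k$ the number $|\{z:(x,z)\in R_i,(z,y)\in R_j\}|$ is a constant $p_{ij}^k$ for all $(x,y)\in R_k$. It is amorphic if every fusion (partition obtained by replacing the nondiagonal relations by unions of them) is again an association scheme. A partition $\{D_1,\dots,D_t\}$ of the nonidentity elements of $G$ corresponds to the relations $R_i=\{(g,h)\in G\times G:gh^{-1}\in D_i\}$, $i\ge1$, together with the diagonal $R_0$. The group $G$. Let $V=\mathbb{F}_q^4$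 (row vectors, standard basis $e_1,\dots,e_4$) with $Q(x)=x_1x_2+x_3x_4$. Elements of $\mathrm{AGL}(4,q)$ are written $[M,u]$ with $M\in\mathrm{GL}(4,q)$, $u\in V$, and product $[M_1,v_1][M_2,v_2]=[M_1M_2,v_1M_2+v_2]$. For $\alpha\in\mathbb{F}_q$ let $$B_\alpha=\begin{pmatrix}1&0&0&0\\0&1&-\alpha&0\\0&0&1&0\\\alpha&0&0&1\end{pmatrix}.$$ Let $U=\langle e_1,e_4\rangle$, $T_U=\{[I,u]:u\in U\}$, $\mathcal{B}=\langle[B_\alpha,\alpha e_2+\beta e_3]:\alpha,\beta\in\mathbb{F}_q\rangle$ and $G=\langle T_U,\mathcal{B}\rangle=T_U:\mathcal{B}$. Each vector $x\in V$ occurs exactly once as the second component of an element $[C,x]\in G$. The sets $D_i$. $D_1=\{[C,x]\in G:Q(x)\text{ is a nonzero square in }\mathbb{F}_q\}$ and $D_2=\{[C,x]\in G:Q(x)\text{ is a nonsquare in }\mathbb{F}_q\}$. Define 2-dimensional subspaces $U_\infty=\langle e_4,e_1\rangle$ and, for $\alpha\in\mathbb{F}_q$, $U_\alpha=\langle e_2+\alpha e_4,\ \alpha e_1-e_3\rangle$. Enumerate $\mathbb{F}_q\cup\{\infty\}=\{\alpha_3,\dots,\alpha_{q+3}\}$ and for $3\le i\le q+3$ set $D_i=\{[C,x]\in G:x\in U_{\alpha_i}-\{0\}\}$. *)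

(* Defs.v *)
From HB Require Import structures.
From mathcomp Require Import all_boot all_order all_fingroup all_algebra.

Set Implicit Arguments.
Unset Strict Implicit.
Unset Printing Implicit Defensive.

Import GroupScope GRing.Theory.
Local Open Scope ring_scope.

Section PartialDifferenceSets.

Variable gT : finGroupType.
Implicit Types (G : {group gT}) (D : {set gT}).

Definition num_diff D (g : gT) : nat :=
  #|[set d : gT * gT | [&& d.1 \in D, d.2 \in D & (d.1 * d.2^-1)%g == g]]|.

(* Regularity (1 \notin D and D = D^-1) is part of the definition. *)
Definition is_pds G D (v k l mu : nat) : Prop :=
  [/\ D \subset G, #|G| = v, #|D| = k, 1%g \notin D & D^-1%g = D] /\
  (forall g, g \in G^#%g ->
     num_diff D g = if g \in D then l else mu).

(* The parameter n + r^2 - 3r is an integer expression; the additive form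
   avoids the truncated subtraction of nat. *)
Definition latin_square_pds G D : Prop :=
  exists n r l : nat,
    (l + 3 * r = n + r ^ 2)%N /\
    is_pds G D (n ^ 2)%N (r * (n - 1))%N l (r ^ 2 - r)%N.

End PartialDifferenceSets.

Section AssociationSchemes.

Variable T : finType.
Implicit Types (X : {set T}) (R : {set T * T}) (P : {set {set T * T}}).

Definition diag X : {set T * T} := [set (x, x) | x in X].

Definition transp R : {set T * T} := [set (xy.2, xy.1) | xy in R].

(* A scheme is given by its set P of relations, the blocks of a partition of
   X * X; t classes means t nondiagonal relations. *)
Definition assoc_scheme X (t : nat) P : Prop :=
  [/\ partition P (setX X X),
      diag X \in P,
      #|P| = t.+1,
      {in P, forall R, transp R \in P} &
      forall Ri Rj Rk, Ri \in P -> Rj \in P -> Rk \in P ->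
        exists pijk : nat, forall x y, (x, y) \in Rk ->
          #|[set z in X | ((x, z) \in Ri) && ((z, y) \in Rj)]| = pijk].

(* The fusion of P along a partition S of its set of nondiagonal relations:
   each block of S is replaced by the union of its members. *)
Definition fusion X (S : {set {set {set T * T}}}) : {set {set T * T}} :=
  diag X |: [set cover C | C in S].

Definition amorphic_scheme X (t : nat) P : Prop :=
  assoc_scheme X t P /\
  forall S, partition S (P :\ diag X) -> assoc_scheme X #|S| (fusion X S).

End AssociationSchemes.

Definition group_rel (gT : finGroupType) (G : {group gT}) (D : {set gT}) :
    {set gT * gT} :=
  [set gh in setX G G | (gh.1 * gh.2^-1)%g \in D].

Section AffineGroup.

Variable F : finFieldType.

(* [M, u] in AGL(4, F), acting on row vectors by x |-> x *m M + u. *)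
Record agl := AGL { agl_lin : {'GL_4[F]}; agl_vec : 'rV[F]_4 }.

Definition agl_pair (g : agl) := (agl_lin g, agl_vec g).
Definition pair_agl (p : {'GL_4[F]} * 'rV[F]_4) := AGL p.1 p.2.
Lemma agl_pairK : cancel agl_pair pair_agl. Proof. by case. Qed.

HB.instance Definition _ := Finite.copy agl (can_type agl_pairK).

Definition agl_one : agl := AGL 1%g 0.
Definition agl_inv (g : agl) : agl :=
  AGL (agl_lin g)^-1%g (- (agl_vec g *m GLval (agl_lin g)^-1%g)).
Definition agl_mul (g h : agl) : agl :=
  AGL (agl_lin g * agl_lin h)%g (agl_vec g *m GLval (agl_lin h) + agl_vec h).

Lemma agl_mulA : associative agl_mul.
Proof.
move=> [M u] [N v] [P w]; congr AGL => /=; first exact: mulgA.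
by rewrite mulmxDl -mulmxA addrA.
Qed.

Lemma agl_mul1 : left_id agl_one agl_mul.
Proof. by move=> [M u]; congr AGL => /=; rewrite ?mul1g // mul0mx add0r. Qed.

Lemma agl_mulV : left_inverse agl_one agl_inv agl_mul.
Proof.
move=> [M u]; congr AGL => /=; first exact: mulVg.
rewrite mulNmx -mulmxA -[X in u *m X]/(GLval (M^-1 * M)%g) mulVg GL_1E.
by rewrite mulmx1 addNr.
Qed.

HB.instance Definition _ := Finite_isGroup.Build agl agl_mulA agl_mul1 agl_mulV.

Definition e (k : nat) : 'rV[F]_4 := delta_mx 0 (inord k.-1).
Definition coordv (x : 'rV[F]_4) (k : nat) : F := x 0 (inord k.-1).

Definition Q (x : 'rV[F]_4) : F :=
  coordv x 1 * coordv x 2 + coordv x 3 * coordv x 4.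

Definition Bmx (a : F) : 'M[F]_4 :=
  \matrix_(i, j) nth 0 (nth [::] [:: [:: 1; 0;  0;   0];
                                     [:: 0; 1; - a;  0];
                                     [:: 0; 0;  1;   0];
                                     [:: a; 0;  0;   1]] i) j.

Lemma Bmx_unit (a : F) : Bmx a \is a GRing.unit.
Proof.
have H b : Bmx b *m Bmx (- b) = 1%:M.
  apply/matrixP=> i j; rewrite !mxE !big_ord_recl big_ord0 !mxE /=.
  case: i => [[|[|[|[|]]]] //= ?]; case: j => [[|[|[|[|]]]] //= ?];
    by rewrite /= ?(mul0r, mulr0, mul1r, mulr1, addr0, add0r, subrr, opprK,
                    addrN, addNr).
have [U _] := mulmx1_unit (H a); exact: U.
Qed.

Definition B (a : F) : {'GL_4[F]} := Sub (Bmx a) (Bmx_unit a).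

Definition U : {vspace 'rV[F]_4} := <<[:: e 1; e 4]>>%VS.

Definition T_U : {set agl} := [set AGL 1%g u | u in U].

Definition Bgrp : {group agl} :=
  <<[set AGL (B ab.1) (ab.1 *: e 2 + ab.2 *: e 3) | ab : F * F]>>%G.

Definition G : {group agl} := (T_U <*> Bgrp)%G.

(* None stands for the point at infinity. *)
Definition Usp (a : option F) : {vspace 'rV[F]_4} :=
  if a is Some a then <<[:: e 2 + a *: e 4; a *: e 1 - e 3]%R>>%VS
  else <<[:: e 4; e 1]>>%VS.

Definition is_square (c : F) : bool := [exists y : F, c == y ^+ 2].

(* alpha i enumerates F and infinity for 3 <= i <= #|F| + 3; only the indices
   1 <= i <= #|F| + 3 are meaningful for D. *)
Definition D (alpha : nat -> option F) (i : nat) : {set agl} :=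
  match i with
  | 0 => set0
  | 1 => [set g in G | (Q (agl_vec g) != 0) && is_square (Q (agl_vec g))]
  | 2 => [set g in G | ~~ is_square (Q (agl_vec g))]
  | _ => [set g in G | (agl_vec g != 0) && (agl_vec g \in Usp (alpha i))]
  end.

End AffineGroup.

(* Main.v *)
Require Import Defs.
From mathcomp Require Import all_boot all_order all_fingroup all_algebra.
From mathcomp Require Import all_solvable all_field.
From mathcomp Require Import ring lra zify.

(** The group [G] consists of the elements [emb x = (B x2, x)], one for each
    vector [x], and the vector part of [emb x * (emb y)^-1] is the image of
    [x - y] under some [Bmx a]. Every [Bmx a] preserves [Q] and each of the
    planes [Usp t]. So the set of group elements whose vector lies in a set [S]
    determined by [Q] and these planes has the same difference counts as [S] in
    the additive group of vectors ([num_diff_lift], [card_vrel_path]), and only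
    the latter group has to be studied.

    There the statement becomes a property of functions. Call a pair [(f, g)]
    of rational functions a [latin_pair] when, for all nonzero [u],
    [conv f g u] is a certain expression in [f u], [g u] and in the sums of
    [f], of [g] and of [f * g]. For [f = g] the indicator of a set [S] it says
    that [S] is a partial difference set of Latin square type; for two
    different indicators it says that the corresponding intersection numbers
    are constant. The condition is bilinear in [(f, g)]. The indicators of the
    sets [S_i] behind the [D_i], hence those of all their unions, are linear
    combinations of three kinds of functions: the indicator of the nonzero
    vectors, the indicators of the planes [Usp t] without 0, and [chi (Q x)]
    for the quadratic character [chi] (with [chi 0 = 0]). So
    [spread_fun_latin] only has to check [latin_pair] on these generators, and
    all unions and fusions are treated at once.

    Reading a vector as a 2 x 2 matrix of determinant [- Q x], the plane
    [Usp t] is the set of matrices that annihilate a column representing the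
    point [t] of the projective line. Two such planes are complementary, which
    settles the pairs of planes. The map [w |-> Q (u - w)] is affine on a
    plane and is there either nonconstant or identically 0, so the character
    sums over planes vanish. For [chi (Q x)] with itself, determinant one row
    and column operations bring [u] to the form [(1, e, 0, 0)]; the convolution
    is then a product of two Jacobi sums of [chi] ([conv_chiQ_hyp_pt]). *)

(** * The quadratic character *)

Section QuadraticCharacter.

#[local] Set Implicit Arguments.
#[local] Unset Strict Implicit.
#[local] Unset Printing Implicit Defensive.
Import Order.TTheory GRing.Theory Num.Theory.
Local Open Scope ring_scope.

Variable F : finFieldType.
Implicit Types (a b c x y : F) (f : F -> rat).

Definition chi c : rat := if c == 0 then 0 else if is_square c then 1 else -1.

Lemma chi0 : chi 0 = 0. Proof. by rewrite /chi eqxx. Qed.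

Lemma chi_sqr c : chi c * chi c = (c != 0)%:R.
Proof.
rewrite /chi; case: eqP => _ //=.
by case: ifP => _; rewrite ?mulrNN mulr1.
Qed.

Lemma is_square_expr x n : ~~ odd n -> is_square (x ^+ n).
Proof.
move=> en; apply/existsP; exists (x ^+ n./2).
by rewrite -exprM muln2 -[in X in X == _](odd_double_half n) (negbTE en).
Qed.

(** The unit group of [F] is cyclic, so two nonsquares are odd powers of one
    generator and their product is an even power. *)
Lemma is_squareM_nonsquare a b :
  ~~ is_square a -> ~~ is_square b -> is_square (a * b).
Proof.
move=> na nb.
have nz c : ~~ is_square c -> c \is a GRing.unit.
  move=> nc; rewrite unitfE; apply: contra nc => /eqP ->.
  by apply/existsP; exists 0; rewrite expr0n.
have /cyclicP[g gen] := field_unit_group_cyclic [set: {unit F}]%G.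
have pow c : c \is a GRing.unit -> exists n, c = FinRing.uval g ^+ n.
  move=> uc; have : FinRing.unit F uc \in <[g]>%g by rewrite -gen inE.
  by case/cycleP => n /(congr1 val) /= ->; exists n; rewrite FinRing.val_unitX.
have [i ai] := pow a (nz a na); have [j bj] := pow b (nz b nb).
rewrite ai bj -exprD; apply: is_square_expr; rewrite oddD.
have oi : odd i by apply: contraNT na => ei; rewrite ai is_square_expr.
have oj : odd j by apply: contraNT nb => ej; rewrite bj is_square_expr.
by rewrite oi oj.
Qed.

Lemma is_squareM_square a b :
  a != 0 -> is_square a -> is_square (a * b) = is_square b.
Proof.
move=> a0 /existsP[x /eqP ax].
have x0 : x != 0 by apply: contraNneq a0 => x0; rewrite ax x0 expr0n.
apply/existsP/existsP => -[y /eqP yE].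
  exists (y / x); rewrite expr_div_n -yE ax mulrC mulKf //.
  by rewrite expf_neq0.
by exists (x * y); rewrite exprMn -yE ax.
Qed.

Lemma chiM : {morph chi : a b / a * b}.
Proof.
move=> a b; rewrite /chi mulf_eq0.
have [->|a0] := eqVneq a 0; first by rewrite !mul0r.
have [->|b0] := eqVneq b 0; first by rewrite orbT mulr0.
case sa : (is_square a); first by rewrite is_squareM_square // mul1r.
case sb : (is_square b); first by rewrite mulrC is_squareM_square // sa mulr1.
by rewrite is_squareM_nonsquare ?sa ?sb // mulrNN mulr1.
Qed.

Lemma sum_affine f k c : k != 0 -> \sum_x f (k * x + c) = \sum_x f x.
Proof.
move=> k0; symmetry; apply: reindex; exists (fun x => (x - c) / k) => x _.
  by rewrite addrK mulrC mulKf.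
by rewrite mulrC divfK // subrK.
Qed.

Hypothesis F2 : (2 : F) != 0.

(** Squaring identifies 1 and -1, hence misses an element of the finite
    field. *)
Lemma nonsquare_exists : exists a, ~~ is_square a.
Proof.
apply/existsP; apply: contraNT F2 => /existsPn allsq.
have surj a : exists y, a == y ^+ 2 by have /negPn/existsP := allsq a.
pose h a := xchoose (surj a).
have hK : cancel h (fun y => y ^+ 2).
  by move=> a; apply/esym/eqP/(xchooseP (surj a)).
have sqinj : injective (fun y : F => y ^+ 2).
  by apply: (can_inj (g := h)); apply: (canF_sym hK).
have /eqP := sqinj 1 (- 1) (esym (sqrrN 1)).
by rewrite -subr_eq0 opprK -mulr2n.
Qed.

Lemma sum_chi : \sum_x chi x = 0.
Proof.
have [a na] := nonsquare_exists.
have a0 : a != 0.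
  apply: contraNneq na => ->.
  by apply/existsP; exists 0; rewrite expr0n.
have : \sum_x chi x = - \sum_x chi x.
  rewrite -[LHS](sum_affine chi 0 a0) -sumrN; apply: eq_bigr => x _.
  by rewrite addr0 chiM {1}/chi (negbTE a0) (negbTE na) mulN1r.
lra.
Qed.

Lemma sum_chi_affine k c : k != 0 -> \sum_x chi (k * x + c) = 0.
Proof. by move=> k0; rewrite sum_affine // sum_chi. Qed.

(** For [c = 1] this is the Jacobi sum of [chi] with itself; the value at 0
    enters through singular vectors. *)
Definition jacobi c : rat := \sum_y chi y * chi (c - y).

Lemma sum_neq0 : \sum_(x : F) (x != 0)%:R = (#|F|%:R - 1 : rat).
Proof.
rewrite (cardD1 (0 : F)) inE natrD addrC addKr -sum1_card natr_sum.
by rewrite [RHS]big_mkcond; apply: eq_bigr => x _; rewrite !inE andbT; case: eqP.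
Qed.

Lemma jacobi0 : jacobi 0 = chi (-1) * (#|F|%:R - 1).
Proof.
rewrite /jacobi -sum_neq0 mulr_sumr; apply: eq_bigr => y _.
by rewrite sub0r -[- y]mulN1r chiM mulrCA chi_sqr.
Qed.

Lemma jacobi_neq0 c : c != 0 -> jacobi c = jacobi 1.
Proof.
move=> c0; rewrite /jacobi -(sum_affine _ 0 c0); apply: eq_bigr => s _.
rewrite addr0 -[c - _](_ : c * (1 - s) = _); last by ring.
by rewrite !chiM mulrACA chi_sqr c0 mul1r.
Qed.

(** Summing over [c] kills every [chi (c - y)], so the value at 0 determines
    the common value elsewhere. *)
Lemma jacobi1 : jacobi 1 = - chi (-1).
Proof.
have q1 : (1 : rat) < #|F|%:R by rewrite ltr1n finNzRing_gt1.
have : \sum_c jacobi c = 0.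
  rewrite /jacobi exchange_big big1 //= => y _; rewrite -mulr_sumr.
  rewrite (eq_bigr (fun c => chi (1 * c - y))) => [|c _]; last by rewrite mul1r.
  by rewrite sum_chi_affine ?oner_neq0 // mulr0.
rewrite (bigD1 0) //= jacobi0 (eq_bigr (fun=> jacobi 1)) => [|c /jacobi_neq0 //].
have -> : \sum_(c : F | c != 0) jacobi 1 = (#|F|%:R - 1) * jacobi 1.
  by rewrite -sum_neq0 mulr_suml [LHS]big_mkcond; apply: eq_bigr => c _; case: eqP;
    rewrite ?mul1r ?mul0r.
rewrite mulrC -mulrDr => /eqP; rewrite mulf_eq0 subr_eq0 gt_eqF //=.
by rewrite addrC addr_eq0 => /eqP.
Qed.

End QuadraticCharacter.

(** * The quadric and its spread *)

Section Geometry.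

#[local] Set Implicit Arguments.
#[local] Unset Strict Implicit.
#[local] Unset Printing Implicit Defensive.
Import Order.TTheory GRing.Theory Num.Theory.
Local Open Scope ring_scope.

Variable F : finFieldType.
Notation V := 'rV[F]_4.
Implicit Types (u v w x y : V) (t : option F) (a b c d : F).

Definition vec4 a b c d : V := \row_(j < 4) nth 0 [:: a; b; c; d] j.

Lemma coord_vec4 a b c d :
  [/\ coordv (vec4 a b c d) 1 = a, coordv (vec4 a b c d) 2 = b,
      coordv (vec4 a b c d) 3 = c & coordv (vec4 a b c d) 4 = d].
Proof. by split; rewrite /coordv mxE inordK. Qed.

Lemma coord_vec41 a b c d : coordv (vec4 a b c d) 1 = a.
Proof. by have [] := coord_vec4 a b c d. Qed.
Lemma coord_vec42 a b c d : coordv (vec4 a b c d) 2 = b.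
Proof. by have [] := coord_vec4 a b c d. Qed.
Lemma coord_vec43 a b c d : coordv (vec4 a b c d) 3 = c.
Proof. by have [] := coord_vec4 a b c d. Qed.
Lemma coord_vec44 a b c d : coordv (vec4 a b c d) 4 = d.
Proof. by have [] := coord_vec4 a b c d. Qed.
Definition vec4E := (coord_vec41, coord_vec42, coord_vec43, coord_vec44).

Lemma coordvD x y k : coordv (x + y) k = coordv x k + coordv y k.
Proof. by rewrite /coordv mxE. Qed.
Lemma coordvN x k : coordv (- x) k = - coordv x k.
Proof. by rewrite /coordv mxE. Qed.
Lemma coordvZ a x k : coordv (a *: x) k = a * coordv x k.
Proof. by rewrite /coordv mxE. Qed.
Lemma coordv0 k : coordv (0 : V) k = 0.
Proof. by rewrite /coordv mxE. Qed.
Definition coordvE := (coordvD, coordvN, coordvZ, coordv0).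

Lemma coordvP x y :
  coordv x 1 = coordv y 1 -> coordv x 2 = coordv y 2 ->
  coordv x 3 = coordv y 3 -> coordv x 4 = coordv y 4 -> x = y.
Proof.
have ordE k (lt : (k < 4)%N) : Ordinal lt = inord k.
  by apply/val_inj; rewrite /= inordK.
by move=> h1 h2 h3 h4; apply/rowP => -[[|[|[|[|//]]]] lt]; rewrite ordE.
Qed.

Lemma vec4_coord x :
  vec4 (coordv x 1) (coordv x 2) (coordv x 3) (coordv x 4) = x.
Proof. by apply: coordvP; rewrite vec4E. Qed.

Lemma coordv_e : [/\ e F 1 = vec4 1 0 0 0, e F 2 = vec4 0 1 0 0,
  e F 3 = vec4 0 0 1 0 & e F 4 = vec4 0 0 0 1].
Proof.
by split; apply/rowP => -[[|[|[|[|//]]]] lt]; rewrite !mxE eqxx -val_eqE /= inordK.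
Qed.

Lemma vec4_eq0 x : (x == 0) = [&& coordv x 1 == 0, coordv x 2 == 0,
   coordv x 3 == 0 & coordv x 4 == 0].
Proof.
apply/eqP/and4P => [-> | [/eqP ? /eqP ? /eqP ? /eqP ?]]; first by rewrite !coordv0.
by apply: coordvP; rewrite coordv0.
Qed.

Lemma sum_vec4 (f : V -> rat) :
  \sum_x f x = \sum_a \sum_b \sum_c \sum_d f (vec4 a b c d).
Proof.
rewrite pair_big; under eq_bigr => i _ do rewrite pair_big.
rewrite pair_big /=.
apply: (reindex (fun p : F * F * (F * F) => vec4 p.1.1 p.1.2 p.2.1 p.2.2)).
exists (fun x => (coordv x 1, coordv x 2, (coordv x 3, coordv x 4))) => x _ /=.
  by rewrite !vec4E; case: x => -[? ?] [].
by rewrite vec4_coord.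
Qed.

(** Homogeneous coordinates [(1, a)] of [Some a] and [(0, 1)] of [None]. *)
Definition pt1 t : F := if t is Some _ then 1 else 0.
Definition pt2 t : F := if t is Some a then a else 1.

(** Read [x] as the matrix with rows [(x1, x3)] and [(x4, - x2)], so that
    [Q x] is minus its determinant: [(form1 t x, form2 t x)] is its product
    with the column [(pt1 t, pt2 t)], and [line_pt t] parametrizes the matrices
    that annihilate this column. *)
Definition form1 t x := pt1 t * coordv x 1 + pt2 t * coordv x 3.
Definition form2 t x := pt1 t * coordv x 4 - pt2 t * coordv x 2.
Definition line_pt t a b : V :=
  vec4 (a * pt2 t) (b * pt1 t) (- (a * pt1 t)) (b * pt2 t).
Definition pt_det t t' := pt1 t' * pt2 t - pt2 t' * pt1 t.

Lemma pt_det_neq0 t t' : t != t' -> pt_det t t' != 0.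
Proof.
rewrite /pt_det; case: t t' => [a|] [b|] //= neq;
  rewrite ?(mul1r, mulr1, mul0r, mulr0, subr0, sub0r) ?oppr_eq0 ?oner_eq0 //.
by rewrite subr_eq0.
Qed.

(** The matrix [line_pt t a b] has both rows proportional to
    [(pt2 t, - pt1 t)], so it maps the column of [t'] to a multiple of [(a, b)].
    In particular distinct planes are complementary. *)
Lemma form_line_pt t t' a b :
  form1 t' (line_pt t a b) = pt_det t t' * a /\
  form2 t' (line_pt t a b) = pt_det t t' * b.
Proof. by rewrite /form1 /form2 /line_pt /pt_det !vec4E; split; ring. Qed.

Lemma line_pt_form t x : form1 t x = 0 -> form2 t x = 0 ->
  exists a b, x = line_pt t a b.
Proof.
rewrite /form1 /form2 /line_pt; case: t => [a|] /= h1 h2.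
  exists (- coordv x 3), (coordv x 2).
  have e1 : coordv x 1 = - (a * coordv x 3) by rewrite -[RHS]addr0 -h1; ring.
  have e2 : coordv x 4 = a * coordv x 2 by rewrite -[RHS]addr0 -h2; ring.
  by apply: coordvP; rewrite vec4E ?e1 ?e2; ring.
exists (coordv x 1), (coordv x 4).
have e1 : coordv x 3 = 0 by rewrite -h1; ring.
have e2 : coordv x 2 = 0 by rewrite -[RHS]oppr0 -h2; ring.
by apply: coordvP; rewrite vec4E ?e1 ?e2; ring.
Qed.

Lemma Usp_line_pt t : Usp t = span [:: line_pt t 0 1; line_pt t 1 0].
Proof.
have [e1 e2 e3 e4] := coordv_e.
by case: t => [a|]; rewrite /Usp /=; congr span; congr [:: _; _];
  apply: coordvP; rewrite ?(e1, e2, e3, e4) !(coordvE, vec4E) /=; ring.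
Qed.

Lemma mem_Usp t x : (x \in Usp t) = (form1 t x == 0) && (form2 t x == 0).
Proof.
rewrite Usp_line_pt; apply/idP/andP => [|[/eqP h1 /eqP h2]].
  rewrite span_cons span_seq1 => /memv_addP[_ /vlineP[b ->] [_ /vlineP[a ->] ->]].
  rewrite /form1 /form2 /line_pt !(coordvE, vec4E).
  by split; apply/eqP; ring.
have [a [b ->]] := line_pt_form h1 h2.
have -> : line_pt t a b = b *: line_pt t 0 1 + a *: line_pt t 1 0.
  by apply: coordvP; rewrite /line_pt !(coordvE, vec4E); ring.
by rewrite memvD ?memvZ ?memv_span // !inE eqxx ?orbT.
Qed.

Lemma line_pt_mem t a b : line_pt t a b \in Usp t.
Proof.
have [h1 h2] := form_line_pt t t a b.
by rewrite mem_Usp h1 h2 /pt_det [pt2 t * _]mulrC subrr !mul0r eqxx.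
Qed.

(** The planes [Usp t] are totally singular: the linear part in the second
    argument is all that survives in the expansion of [Q]. *)
Lemma Q_sub_line_pt t u a b :
  Q (u - line_pt t a b) = Q u - b * form1 t u + a * form2 t u.
Proof.
by rewrite /Q /form1 /form2 /line_pt !(coordvE, vec4E); ring.
Qed.

Lemma Q0 : Q (0 : V) = 0.
Proof. by rewrite /Q !coordv0 !mul0r addr0. Qed.

Lemma QN x : Q (- x) = Q x.
Proof. by rewrite /Q !coordvN !mulrNN. Qed.

Lemma Q_Usp t x : x \in Usp t -> Q x = 0.
Proof.
rewrite mem_Usp => /andP[/eqP h1 /eqP h2]; have [a [b xE]] := line_pt_form h1 h2.
have := Q_sub_line_pt t x a b.
by rewrite -xE subrr Q0 h1 h2 !mulr0 addr0 subr0 => <-.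
Qed.

Lemma Usp_cap t t' x : t != t' -> x \in Usp t -> x \in Usp t' -> x = 0.
Proof.
move=> /pt_det_neq0 d0; rewrite !mem_Usp => /andP[/eqP h1 /eqP h2].
have [a [b ->]] := line_pt_form h1 h2.
have [-> ->] := form_line_pt t t' a b.
rewrite !mulf_eq0 (negbTE d0) /= => /andP[/eqP -> /eqP ->].
by apply/eqP; rewrite vec4_eq0 !vec4E !mul0r oppr0 eqxx.
Qed.

(** A matrix of determinant 0 has a kernel. *)
Lemma singular_Usp x : Q x = 0 -> exists t, x \in Usp t.
Proof.
rewrite /Q => Qx.
have [x2|x2] := eqVneq (coordv x 2) 0; last first.
  exists (Some (coordv x 4 / coordv x 2)); rewrite mem_Usp /form1 /form2 /=.
  apply/andP; split; apply/eqP; last by field.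
  apply: (mulfI x2); rewrite [in RHS]mulr0 -[RHS]Qx; by field.
have [x3|x3] := eqVneq (coordv x 3) 0.
  exists None; rewrite mem_Usp /form1 /form2 x2 x3 /=.
  by rewrite !mul0r !mulr0 subr0 addr0 eqxx.
exists (Some (- coordv x 1 / coordv x 3)); rewrite mem_Usp /form1 /form2 /=.
apply/andP; split; apply/eqP; first by field.
apply: (mulfI x3); rewrite x2 [in RHS]mulr0 -[RHS]Qx x2; ring.
Qed.

Lemma sum_Usp t (f : V -> rat) :
  \sum_(x | x \in Usp t) f x = \sum_a \sum_b f (line_pt t a b).
Proof.
rewrite pair_big /=.
pose back x := if t is Some _ then (- coordv x 3, coordv x 2)
               else (coordv x 1, coordv x 4).
rewrite (reindex (fun p : F * F => line_pt t p.1 p.2)) /=.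
  by apply: eq_bigl => p; rewrite line_pt_mem.
exists back => [[a b] _|x]; rewrite ?inE ?mem_Usp /=.
  by rewrite /back /line_pt; case: (t) => [c|]; rewrite !vec4E /=;
    congr (_, _); ring.
move=> /andP[/eqP h1 /eqP h2]; have [a [b ->]] := line_pt_form h1 h2.
by rewrite /back /line_pt; case: (t) => [c|] /=; rewrite !vec4E;
  apply: coordvP; rewrite !vec4E; ring.
Qed.
End Geometry.

(** * Convolution on the space of vectors *)

Section Convolution.

#[local] Set Implicit Arguments.
#[local] Unset Strict Implicit.
#[local] Unset Printing Implicit Defensive.
Import Order.TTheory GRing.Theory Num.Theory.
Local Open Scope ring_scope.

Variable F : finFieldType.
Notation V := 'rV[F]_4.
Notation q := (#|F|%:R : rat).
Implicit Types (u v w x y : V) (t : option F) (a b c d : F) (f g h : V -> rat).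

Definition conv f g u : rat := \sum_w f w * g (u - w).

(** For the indicator of a set of size [r * (q ^ 2 - 1)], this is [r]. *)
Definition lrank f : rat := (\sum_x f x) / (q ^+ 2 - 1).

(** For [f = g] an indicator function this is the condition on a partial
    difference set of Latin square type; it is bilinear in [(f, g)]. *)
Definition latin_pair f g := forall u, u != 0 ->
  conv f g u = lrank f * lrank g - lrank g * f u - lrank f * g u
               + q ^+ 2 * (f u * g u) - lrank (fun x => f x * g x).

Definition punct x : rat := (x != 0)%:R.
Definition chiQ x : rat := chi (Q x).
Definition plane t x : rat := (x \in Usp t)%:R.
(** Projectively a line on the quadric; [plane t] is its set of vectors. *)
Definition line t x : rat := plane t x - (x == 0)%:R.

Lemma q_gt1 : 1 < q. Proof. by rewrite ltr1n finNzRing_gt1. Qed.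

Lemma q2_neq1 : q ^+ 2 - 1 != 0.
Proof. by have := q_gt1; rewrite -[_ ^+ 2]/(q * q) => ?; apply/eqP; nra. Qed.

Lemma sum_sub u f : \sum_w f (u - w) = \sum_w f w.
Proof. by symmetry; apply: (reindex_inj (subrI u)). Qed.

Lemma convC f g u : conv f g u = conv g f u.
Proof.
rewrite /conv -(sum_sub u); apply: eq_bigr => w _.
by rewrite subKr mulrC.
Qed.

Lemma sum_delta f u : \sum_w (w == u)%:R * f w = f u.
Proof.
rewrite (bigD1 u) //= eqxx mul1r big1 ?addr0 // => w /negbTE ->.
by rewrite mul0r.
Qed.

Lemma eq_lrank f g : f =1 g -> lrank f = lrank g.
Proof. by move=> fg; rewrite /lrank (eq_bigr g) // => x _; apply: fg. Qed.

Lemma lrank_lin (a : rat) f g h : (forall x, h x = a * f x + g x) ->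
  lrank h = a * lrank f + lrank g.
Proof.
move=> hE; rewrite /lrank mulrA -mulrDl mulr_sumr -big_split /=.
by congr (_ / _); apply: eq_bigr => x _.
Qed.

Lemma conv_lin (a : rat) f1 f2 f g u : (forall x, f x = a * f1 x + f2 x) ->
  conv f g u = a * conv f1 g u + conv f2 g u.
Proof.
move=> fE; rewrite /conv mulr_sumr -big_split /=; apply: eq_bigr => x _.
by rewrite fE mulrDl mulrA.
Qed.

Lemma latin_pairC f g : latin_pair f g -> latin_pair g f.
Proof.
move=> fg u u0; rewrite convC fg //.
have -> : lrank (fun x => g x * f x) = lrank (fun x => f x * g x).
  by apply: eq_lrank => x; rewrite mulrC.
ring.
Qed.

Lemma latin_pair_lin (a : rat) f1 f2 f g : (forall x, f x = a * f1 x + f2 x) ->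
  latin_pair f1 g -> latin_pair f2 g -> latin_pair f g.
Proof.
move=> fE f1g f2g u u0.
rewrite (conv_lin _ _ fE) f1g // f2g // (lrank_lin fE) fE.
rewrite (@lrank_lin a (fun x => f1 x * g x) (fun x => f2 x * g x)
  (fun x => f x * g x)) => [|x]; first by ring.
by rewrite fE mulrDl mulrA.
Qed.

Lemma sum_punct : \sum_x punct x = q ^+ 4 - 1.
Proof.
have -> : q ^+ 4 = \sum_(x : V) 1.
  by rewrite sumr_const card_mx mul1n natrX.
rewrite (bigD1 (0 : V)) //= [in RHS](bigD1 (0 : V)) //=.
rewrite /punct eqxx add0r addrAC subrr add0r; apply: eq_bigr => x ->.
by [].
Qed.

Lemma lrank_punct : lrank punct = q ^+ 2 + 1.
Proof. by rewrite /lrank sum_punct; field; apply: q2_neq1. Qed.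

(** Convolving with the indicator of the nonzero vectors gives
    [\sum g - g u]; since [g 0 = 0], the product [punct * g] is [g] again. *)
Lemma latin_pair_punct g : g 0 = 0 -> latin_pair punct g.
Proof.
move=> g0 u u0; rewrite lrank_punct.
have -> : lrank (fun x => punct x * g x) = lrank g.
  by apply: eq_lrank => x; rewrite /punct; case: eqP => [->|_];
    rewrite ?g0 ?mulr0 ?mul1r.
have sg : \sum_x g x = (q ^+ 2 - 1) * lrank g.
  by rewrite mulrC divfK // q2_neq1.
have -> : conv punct g u = \sum_w g (u - w) - \sum_w (w == 0)%:R * g (u - w).
  rewrite -sumrB; apply: eq_bigr => w _.
  by rewrite /punct; case: eqP => _ /=; ring.
by rewrite (sum_delta (fun w => g (u - w))) subr0 sum_sub sg /punct u0 /=; ring.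
Qed.

Lemma sum_plane t f : \sum_x plane t x * f x = \sum_a \sum_b f (line_pt t a b).
Proof.
rewrite -sum_Usp [RHS]big_mkcond /=; apply: eq_bigr => x _.
by rewrite /plane; case: (x \in _); rewrite ?mul1r ?mul0r.
Qed.

Lemma sum1_F : \sum_(a : F) 1 = q.
Proof. by rewrite sumr_const. Qed.

Lemma sum_line t : \sum_x line t x = q ^+ 2 - 1.
Proof.
rewrite sumrB; congr (_ - _).
  under eq_bigr => x _ do rewrite -[plane t x]mulr1.
  rewrite sum_plane /=.
  by under eq_bigr => a _ do rewrite sum1_F -[q]mul1r; rewrite -mulr_suml sum1_F.
by under eq_bigr => x _ do rewrite -[_%:R]mulr1; rewrite (sum_delta (fun=> 1)).
Qed.

Lemma lrank_line t : lrank (line t) = 1.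
Proof. by rewrite /lrank sum_line divff // q2_neq1. Qed.

Lemma line0 t : line t 0 = 0.
Proof. by rewrite /line /plane mem0v eqxx subrr. Qed.

Lemma line_neq0 t u : u != 0 -> line t u = plane t u.
Proof. by move=> u0; rewrite /line (negbTE u0) subr0. Qed.

Lemma conv_line t t' u : u != 0 ->
  conv (line t) (line t') u = conv (plane t) (plane t') u - plane t u - plane t' u.
Proof.
move=> u0.
have d1 : plane t' u = \sum_w (w == 0)%:R * plane t' (u - w).
  by rewrite (sum_delta (fun w => plane t' (u - w))) subr0.
have d2 : plane t u = \sum_w (w == u)%:R * plane t w by rewrite sum_delta.
rewrite [in RHS]d1 [in X in _ - X - _]d2 /conv -!sumrB; apply: eq_bigr => w _.
rewrite /line subr_eq0 [u == w]eq_sym.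
case: (eqVneq w 0) => [->|]; last by case: (w == u) => _; rewrite /=; ring.
by rewrite [0 == u]eq_sym (negbTE u0) /=; ring.
Qed.

(** Complementary planes: [u] has exactly one decomposition. *)
Lemma conv_plane_neq t t' u : t != t' -> conv (plane t) (plane t') u = 1.
Proof.
move=> /pt_det_neq0 d0; rewrite /conv sum_plane.
pose a0 := form1 t' u / pt_det t t'; pose b0 := form2 t' u / pt_det t t'.
have pE a b : plane t' (u - line_pt t a b) = (a == a0)%:R * (b == b0)%:R.
  rewrite /plane mem_Usp.
  have -> : form1 t' (u - line_pt t a b) = pt_det t t' * (a0 - a).
    rewrite mulrBr [_ * a0]mulrC divfK // -(form_line_pt t t' a b).1.
    by rewrite /form1 !coordvE; ring.
  have -> : form2 t' (u - line_pt t a b) = pt_det t t' * (b0 - b).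
    rewrite mulrBr [_ * b0]mulrC divfK // -(form_line_pt t t' a b).2.
    by rewrite /form2 !coordvE; ring.
  rewrite !mulf_eq0 (negbTE d0) /= !subr_eq0 [a0 == _]eq_sym [b0 == _]eq_sym.
  by rewrite -natrM mulnb.
have sd (c : F) : \sum_a (a == c)%:R = 1 :> rat.
  by rewrite (bigD1 c) //= eqxx big1 ?addr0 // => a /negbTE ->.
under eq_bigr => a _ do (under eq_bigr => b _ do rewrite pE).
by under eq_bigr => a _ do rewrite -mulr_sumr sd mulr1; rewrite sd.
Qed.

Lemma conv_plane t u : conv (plane t) (plane t) u = q ^+ 2 * plane t u.
Proof.
rewrite /conv sum_plane.
under eq_bigr => a _ do (under eq_bigr => b _ do
  rewrite /plane rpredBr ?line_pt_mem // -/(plane t u) -[plane t u]mul1r).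
under eq_bigr => a _ do rewrite -mulr_suml sum1_F -[q]mul1r -mulrA.
by rewrite -mulr_suml sum1_F mulrA.
Qed.

Lemma plane_disjoint t t' u : t != t' -> u != 0 -> plane t u * plane t' u = 0.
Proof.
move=> tt' u0; rewrite -natrM mulnb; case: andP => // -[ut ut'].
by rewrite (Usp_cap tt' ut ut') eqxx in u0.
Qed.

Lemma latin_pair_line t t' : latin_pair (line t) (line t').
Proof.
move=> u u0; rewrite !lrank_line conv_line // !line_neq0 //.
have [<-|tt'] := eqVneq t t'.
  rewrite conv_plane (@eq_lrank _ (line t)) ?lrank_line.
    have -> : plane t u * plane t u = plane t u by rewrite -natrM mulnb andbb.
    by ring.
  move=> x; have [->|x0] := eqVneq x 0; first by rewrite line0 mul0r.
  by rewrite line_neq0 // -natrM mulnb andbb.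
rewrite conv_plane_neq // plane_disjoint // (@eq_lrank _ (fun=> 0)).
  by rewrite /lrank big1_eq; ring.
move=> x; have [->|x0] := eqVneq x 0; first by rewrite line0 mul0r.
by rewrite !line_neq0 // plane_disjoint.
Qed.
End Convolution.

(** * Convolution with the character of the quadratic form *)

Section ChiConvolution.

#[local] Set Implicit Arguments.
#[local] Unset Strict Implicit.
#[local] Unset Printing Implicit Defensive.
Import Order.TTheory GRing.Theory Num.Theory.
Local Open Scope ring_scope.

Variable F : finFieldType.
Hypothesis F2 : (2 : F) != 0.
Notation V := 'rV[F]_4.
Notation q := (#|F|%:R : rat).
Implicit Types (u v w x y : V) (t : option F) (a b c d : F) (f g h : V -> rat).
Notation punct := (@punct F).
Notation chiQ := (@chiQ F).

(** On the plane, [Q (u - w)] is affine in [w]. If its linear part vanishes then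
    [u] lies in the plane and all terms are 0; otherwise all values are taken
    equally often and [chi] sums to 0. *)
Lemma sum_plane_chiQ t u : \sum_w plane t w * chiQ (u - w) = 0.
Proof.
rewrite (sum_plane t (fun w => chiQ (u - w))).
under eq_bigr => a _ do (under eq_bigr => b _ do rewrite /chiQ Q_sub_line_pt).
have [h1|h1] := eqVneq (form1 t u) 0; last first.
  rewrite big1 // => a _; rewrite (eq_bigr (fun b => chi (- form1 t u * b
    + (Q u + a * form2 t u)))) => [|b _]; last by congr chi; ring.
  by rewrite sum_chi_affine // oppr_eq0.
have [h2|h2] := eqVneq (form2 t u) 0; last first.
  rewrite exchange_big big1 //= => b _; rewrite (eq_bigr (fun a => chi (form2 t u * a
    + (Q u - b * form1 t u)))) => [|a _]; last by congr chi; ring.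
  by rewrite sum_chi_affine.
have Qu : Q u = 0 by apply: (@Q_Usp _ t); rewrite mem_Usp h1 h2 eqxx.
rewrite big1 // => a _; rewrite big1 // => b _.
by rewrite Qu h1 h2 !mulr0 subr0 addr0 chi0.
Qed.

(** The translates of one plane cover every vector equally often. *)
Lemma sum_chiQ : \sum_x chiQ x = 0.
Proof.
have : \sum_u \sum_w plane None w * chiQ (u - w) = 0.
  by rewrite big1 // => u _; apply: sum_plane_chiQ.
rewrite exchange_big /=.
under eq_bigr => w _.
  rewrite -mulr_sumr.
  rewrite (_ : \sum_u _ = \sum_u chiQ u).
  over.
  by symmetry; apply: (reindex_inj (addIr (- w))).
rewrite (sum_plane _ (fun=> \sum_u chiQ u)) /= !sumr_const -mulrnA => /eqP.
by rewrite mulrn_eq0 muln_eq0 orbb gtn_eqF ?(ltnW (finNzRing_gt1 F)) // => /eqP.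
Qed.

Lemma lrank_chiQ : lrank chiQ = 0.
Proof. by rewrite /lrank sum_chiQ mul0r. Qed.

Lemma chiQN x : chiQ (- x) = chiQ x. Proof. by rewrite /chiQ QN. Qed.

Lemma latin_pair_chiQ_line t : latin_pair chiQ (line t).
Proof.
move=> u u0; rewrite lrank_chiQ lrank_line convC.
have -> : conv (line t) chiQ u = \sum_w plane t w * chiQ (u - w)
    - \sum_w (w == 0)%:R * chiQ (u - w).
  by rewrite -sumrB; apply: eq_bigr => w _; rewrite -mulrBl.
rewrite sum_plane_chiQ (sum_delta (fun w => chiQ (u - w))) subr0.
have chi_line x : chiQ x * line t x = 0.
  have [->|x0] := eqVneq x 0; first by rewrite line0 mulr0.
  rewrite line_neq0 // /plane; case: (boolP (x \in Usp t)); rewrite ?mulr0 //.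
  by move=> /Q_Usp; rewrite /chiQ => ->; rewrite chi0 mul0r.
rewrite chi_line (@eq_lrank _ _ (fun=> 0)) //.
by rewrite /lrank big1_eq; ring.
Qed.

(** Each nonzero singular vector lies in exactly one of the planes. *)
Lemma chiQ_sqr x : chiQ x * chiQ x = punct x - \sum_t line t x.
Proof.
have [->|x0] := eqVneq x 0.
  rewrite /chiQ /punct Q0 chi0 eqxx mul0r big1 ?subr0 // => t _; exact: line0.
rewrite /chiQ /punct chi_sqr x0.
under eq_bigr => t _ do rewrite line_neq0 //.
have [Qx|Qx] := eqVneq (Q x) 0.
  have [t xt] := singular_Usp Qx.
  rewrite (bigD1 t) //= big1 => [|s st]; first by rewrite /plane xt /=; ring.
  rewrite /plane; case: (boolP (x \in Usp s)) => // xs.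
  by rewrite (Usp_cap st xs xt) eqxx in x0.
rewrite big1 => [|t _]; first by rewrite subr0.
by rewrite /plane; case: (boolP (x \in Usp t)) => // /Q_Usp xt; rewrite xt eqxx in Qx.
Qed.

Lemma sum_chiQ_sqr : \sum_x chiQ x * chiQ x = (q ^+ 2 - 1) * (q ^+ 2 - q).
Proof.
under eq_bigr => x _ do rewrite chiQ_sqr.
rewrite sumrB sum_punct exchange_big /=.
under eq_bigr => t _ do rewrite sum_line.
by rewrite sumr_const card_option mulrS -[(q ^+ 2 - 1) *+ _]mulr_natl; ring.
Qed.

Lemma lrank_chiQ_sqr : lrank (fun x => chiQ x * chiQ x) = q ^+ 2 - q.
Proof. by rewrite /lrank sum_chiQ_sqr mulrC mulKf // q2_neq1. Qed.

Lemma conv_chiQ_isometry (phi : V -> V) u :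
  {morph phi : x y / x - y} -> injective phi -> (forall x, Q (phi x) = Q x) ->
  conv chiQ chiQ (phi u) = conv chiQ chiQ u.
Proof.
move=> phiB phi_inj Qphi; rewrite /conv (reindex_inj phi_inj) /=.
by apply: eq_bigr => w _; rewrite -phiB /chiQ !Qphi.
Qed.

Lemma inj_ker (phi : V -> V) : {morph phi : x y / x - y} ->
  (forall x, phi x = 0 -> x = 0) -> injective phi.
Proof.
move=> phiB ker x y xy; apply/eqP; rewrite -subr_eq0; apply/eqP/ker.
by rewrite phiB xy subrr.
Qed.

Definition hyp_pt e : V := vec4 1 e 0 0.

(** In matrix form, [phi] scales the rows by [k] and [1 / k], then adds
    multiples of the first row to the second and of the first column to the
    second. With its multipliers read off [u], it maps the diagonal matrix
    [hyp_pt (Q u)] to [u]. *)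
Lemma conv_chiQ_normal1 u : coordv u 1 != 0 ->
  conv chiQ chiQ u = conv chiQ chiQ (hyp_pt (Q u)).
Proof.
set k := coordv u 1 => k0.
pose x4' x := coordv x 4 / k + coordv u 4 * coordv x 1.
pose phi x := vec4 (k * coordv x 1)
  (coordv x 2 / k - coordv u 4 * coordv x 3 - coordv u 3 / k * x4' x)
  (k * coordv x 3 + coordv u 3 * coordv x 1) (x4' x).
have phiB : {morph phi : x y / x - y}.
  move=> x y; rewrite /phi /x4'; apply: coordvP; rewrite !(coordvE, vec4E); ring.
have -> : u = phi (hyp_pt (Q u)).
  by apply: coordvP; rewrite /phi /x4' /hyp_pt !vec4E /Q -/k; field.
rewrite [in RHS](_ : Q (phi _) = Q u).
  apply: conv_chiQ_isometry => // [|x].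
    apply: inj_ker => // x /eqP; rewrite vec4_eq0 /phi !vec4E.
    case/and4P => /eqP h1 /eqP h2 /eqP h3 /eqP h4.
    have x1 : coordv x 1 = 0 by apply: (mulfI k0); rewrite h1 mulr0.
    have x3 : coordv x 3 = 0.
      by apply: (mulfI k0); rewrite [RHS]mulr0 -h3 x1; ring.
    have x4 : coordv x 4 = 0.
      by apply: (mulIf (invr_neq0 k0)); rewrite mul0r -h4 /x4' x1; ring.
    have x2 : coordv x 2 = 0.
      by apply: (mulIf (invr_neq0 k0)); rewrite mul0r -h2 h4 x3; ring.
    by apply/eqP; rewrite vec4_eq0 x1 x2 x3 x4 eqxx.
  by rewrite /phi /x4' /Q !vec4E; field.
congr Q; apply: coordvP; rewrite /phi /x4' /hyp_pt !vec4E /Q -/k; by field.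
Qed.

Definition swap12 x := vec4 (coordv x 2) (coordv x 1) (coordv x 3) (coordv x 4).
Definition swap13 x := vec4 (coordv x 3) (coordv x 4) (coordv x 1) (coordv x 2).

Lemma conv_chiQ_swap12 u : conv chiQ chiQ (swap12 u) = conv chiQ chiQ u.
Proof.
apply: conv_chiQ_isometry => [x y||x].
- by apply: coordvP; rewrite !(coordvE, vec4E).
- by apply: (@can_inj _ _ _ swap12) => x; apply: coordvP; rewrite !vec4E.
- by rewrite /Q !vec4E; ring.
Qed.

Lemma conv_chiQ_swap13 u : conv chiQ chiQ (swap13 u) = conv chiQ chiQ u.
Proof.
apply: conv_chiQ_isometry => [x y||x].
- by apply: coordvP; rewrite !(coordvE, vec4E).
- by apply: (@can_inj _ _ _ swap13) => x; apply: coordvP; rewrite !vec4E.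
- by rewrite /Q !vec4E; ring.
Qed.

(** The isometries [swap12] and [swap13] act transitively on the coordinates, so
    any nonzero coordinate can be moved to the first place. *)
Lemma conv_chiQ_normal u : u != 0 ->
  conv chiQ chiQ u = conv chiQ chiQ (hyp_pt (Q u)).
Proof.
rewrite vec4_eq0.
have [u1|u1 _] := eqVneq (coordv u 1) 0; last exact: conv_chiQ_normal1.
have [u2|u2 _] := eqVneq (coordv u 2) 0; last first.
  rewrite -conv_chiQ_swap12 conv_chiQ_normal1 ?vec4E //.
  by congr (conv _ _ (hyp_pt _)); rewrite /Q !vec4E; ring.
have [u3|u3 _] := eqVneq (coordv u 3) 0; last first.
  rewrite -conv_chiQ_swap13 conv_chiQ_normal1 ?vec4E //.
  by congr (conv _ _ (hyp_pt _)); rewrite /Q !vec4E; ring.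
have [//|u4 _] := eqVneq (coordv u 4) 0.
rewrite -conv_chiQ_swap13 -conv_chiQ_swap12 conv_chiQ_normal1 ?vec4E //.
by congr (conv _ _ (hyp_pt _)); rewrite /Q !vec4E; ring.
Qed.

(** With [a, b, c, d] the coordinates of the summation variable, [a] and [d]
    fixed and [d] nonzero, [d * c + a * b] can replace [c] as a variable, and
    then [b] only occurs in one factor, linearly. So only [d = 0] contributes,
    where the sum splits. *)
Lemma conv_chiQ_hyp_pt e :
  conv chiQ chiQ (hyp_pt e) = q * (jacobi (1 : F) * jacobi e).
Proof.
rewrite /conv sum_vec4.
have QE a b c d : chiQ (vec4 a b c d) * chiQ (hyp_pt e - vec4 a b c d) =
  chi (d * c + a * b) * chi (d * c + a * b + (- 1 * b + (1 - a) * e)).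
  by rewrite /chiQ /Q /hyp_pt !(coordvE, vec4E); congr (_ * _); congr chi; ring.
under eq_bigr => a _ do (under eq_bigr => b _ do (under eq_bigr => c _ do
  (under eq_bigr => d _ do rewrite QE))).
have inner a : \sum_b \sum_c \sum_d chi (d * c + a * b) *
      chi (d * c + a * b + (- 1 * b + (1 - a) * e))
    = q * (chi a * chi (1 - a) * jacobi e).
  under eq_bigr => b _ do rewrite exchange_big /=.
  rewrite exchange_big (bigD1 0) //= [X in _ + X]big1 => [|d d0].
    rewrite addr0 /jacobi !mulr_sumr; apply: eq_bigr => b _.
    rewrite (eq_bigr (fun=> chi a * chi (1 - a) * (chi b * chi (e - b)))) => [|c _].
      by rewrite sumr_const mulr_natl.
    rewrite -!chiM; congr chi; ring.
  under eq_bigr => b _ do rewrite (sum_affine (fun z => chi z *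
    chi (z + (- 1 * b + (1 - a) * e))) _ d0).
  rewrite exchange_big big1 //= => z _; rewrite -mulr_sumr.
  rewrite (eq_bigr (fun b => chi (- 1 * b + (z + (1 - a) * e)))) => [|b _].
    by rewrite sum_chi_affine ?mulr0 // oppr_eq0 oner_eq0.
  by congr chi; ring.
under eq_bigr => a _ do rewrite inner.
by rewrite -mulr_sumr -mulr_suml.
Qed.

Lemma latin_pair_chiQ : latin_pair chiQ chiQ.
Proof.
move=> u u0; rewrite lrank_chiQ lrank_chiQ_sqr conv_chiQ_normal // conv_chiQ_hyp_pt.
have -> : chiQ u * chiQ u = (Q u != 0)%:R by apply: chi_sqr.
rewrite jacobi1 //.
have chiN1 : chi (-1 : F) * chi (-1 : F) = 1 by rewrite chi_sqr oppr_eq0 oner_eq0.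
have [->|Qu] := eqVneq (Q u) 0.
  by rewrite jacobi0 mulNr mulrA chiN1 /=; ring.
by rewrite jacobi_neq0 // jacobi1 // mulrNN chiN1 /=; ring.
Qed.
End ChiConvolution.

(** * The algebra of invariant functions *)

Section InvariantFunctions.

#[local] Set Implicit Arguments.
#[local] Unset Strict Implicit.
#[local] Unset Printing Implicit Defensive.
Import Order.TTheory GRing.Theory Num.Theory.
Local Open Scope ring_scope.

Variable F : finFieldType.
Notation V := 'rV[F]_4.
Notation q := (#|F|%:R : rat).
Implicit Types (u v w x y : V) (t : option F) (f g h : V -> rat) (S : {set V}).
Notation punct := (@punct F).
Notation chiQ := (@chiQ F).

(** The span of the generators, given inductively so that every linear property
    is proved by checking it on the three kinds of generators. *)
Inductive spread_fun : (V -> rat) -> Prop :=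
| spread_fun_punct : spread_fun punct
| spread_fun_chiQ : spread_fun chiQ
| spread_fun_line t : spread_fun (line t)
| spread_fun_lin (a : rat) f g h : spread_fun f -> spread_fun g ->
    (forall x, h x = a * f x + g x) -> spread_fun h.

Lemma mulmx_Bmx x a : x *m Bmx a = vec4 (coordv x 1 + a * coordv x 4)
  (coordv x 2) (coordv x 3 - a * coordv x 2) (coordv x 4).
Proof.
rewrite /coordv; apply/rowP => j; rewrite !mxE !big_ord_recl big_ord0 !mxE.
have -> : lift ord0 (lift ord0 (lift ord0 ord0)) = inord 3 :> 'I_4.
  by apply/val_inj; rewrite /= inordK.
have -> : lift ord0 (lift ord0 ord0) = inord 2 :> 'I_4.
  by apply/val_inj; rewrite /= inordK.
have -> : lift ord0 ord0 = inord 1 :> 'I_4.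
  by apply/val_inj; rewrite /= inordK.
have -> : ord0 = inord 0 :> 'I_4.
  by apply/val_inj; rewrite /= inordK.
rewrite !inordK //.
by case: j => [[|[|[|[|//]]]] ?] /=; ring.
Qed.

Lemma Q_Bmx x a : Q (x *m Bmx a) = Q x.
Proof. by rewrite mulmx_Bmx /Q !vec4E; ring. Qed.

Lemma Bmx_eq0 x a : (x *m Bmx a == 0) = (x == 0).
Proof.
apply/eqP/eqP => [|->]; last by rewrite mul0mx.
by move/(congr1 (mulmx^~ (invmx (Bmx a)))); rewrite mulmxK ?Bmx_unit // mul0mx.
Qed.

Lemma form_Bmx t x a :
  form1 t (x *m Bmx a) = form1 t x + a * form2 t x /\
  form2 t (x *m Bmx a) = form2 t x.
Proof. by rewrite /form1 /form2 mulmx_Bmx !vec4E; split; ring. Qed.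

(** In matrix form, [Bmx a] adds a multiple of the second row to the first,
    and row operations do not change the kernel. *)
Lemma Usp_Bmx t x a : (x *m Bmx a \in Usp t) = (x \in Usp t).
Proof.
rewrite !mem_Usp; have [-> ->] := form_Bmx t x a.
have [->|] := eqVneq (form2 t x) 0; last by rewrite !andbF.
by rewrite mulr0 addr0.
Qed.

(** Difference counts carry over from the additive group to [G] because of
    this invariance and of [spread_funN]. *)
Lemma spread_fun_Bmx f x a : spread_fun f -> f (x *m Bmx a) = f x.
Proof.
elim=> [||t|b {}f g h _ fB _ gB hE]; last by rewrite !hE fB gB.
- by rewrite /punct Bmx_eq0.
- by rewrite /chiQ Q_Bmx.
- by rewrite /line /plane Usp_Bmx Bmx_eq0.
Qed.

Lemma spread_fun0 f : spread_fun f -> f 0 = 0.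
Proof.
elim=> [||t|b {}f g h _ f0 _ g0 hE]; last by rewrite hE f0 g0 mulr0 addr0.
- by rewrite /punct eqxx.
- by rewrite /chiQ Q0 chi0.
- exact: line0.
Qed.

Lemma spread_funN f x : spread_fun f -> f (- x) = f x.
Proof.
elim=> [||t|b {}f g h _ fN _ gN hE]; last by rewrite !hE fN gN.
- by rewrite /punct oppr_eq0.
- exact: chiQN.
- by rewrite /line /plane rpredN oppr_eq0.
Qed.

Lemma spread_fun_cst0 : spread_fun (fun=> 0).
Proof.
apply: (@spread_fun_lin (-1) punct punct); try exact: spread_fun_punct.
by move=> x; rewrite mulN1r addNr.
Qed.

Lemma spread_fun_sum (I : Type) (r : seq I) (P : pred I) (f : I -> V -> rat) :
  (forall i, P i -> spread_fun (f i)) ->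
  spread_fun (fun x => \sum_(i <- r | P i) f i x).
Proof.
move=> fP; elim: r => [|i r IHr].
  apply: (@spread_fun_lin 0 _ _ _ spread_fun_cst0 spread_fun_cst0) => x.
  by rewrite big_nil mul0r add0r.
case Pi: (P i).
  by apply: (@spread_fun_lin 1 _ _ _ (fP i Pi) IHr) => x; rewrite big_cons Pi mul1r.
apply: (@spread_fun_lin 0 _ _ _ spread_fun_cst0 IHr) => x.
by rewrite big_cons Pi mul0r add0r.
Qed.

Lemma spread_fun_chiQ_sqr : spread_fun (fun x => chiQ x * chiQ x).
Proof.
have sl : spread_fun (fun x => \sum_t line t x).
  by apply: spread_fun_sum => t _; apply: spread_fun_line.
apply: (@spread_fun_lin (-1) _ _ _ sl spread_fun_punct) => x.
by rewrite chiQ_sqr; ring.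
Qed.

Definition indic S x : rat := (x \in S)%:R.

Lemma sum_indic S : \sum_x indic S x = #|S|%:R.
Proof.
rewrite -sum1_card natr_sum [RHS]big_mkcond /=; apply: eq_bigr => x _.
by rewrite /indic; case: (_ \in _).
Qed.

Section DisjointUnion.

Variables (I : finType) (J : {set I}) (S : I -> {set V}).
Hypothesis dis : {in J &, forall i j, j != i -> [disjoint S i & S j]}.

Lemma indic_bigcup x : indic (\bigcup_(i in J) S i) x = \sum_(i in J) indic (S i) x.
Proof.
rewrite /indic; case: bigcupP => [[i iJ xi]|nx]; last first.
  rewrite big1 // => i iJ; case: (boolP (x \in S i)) => // xi.
  by case: nx; exists i.
rewrite (bigD1 i) //= xi big1 ?addr0 // => j /andP[jJ ji].
by rewrite (disjointFr (dis iJ jJ ji) xi).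
Qed.

Lemma spread_fun_bigcup :
  (forall i, i \in J -> spread_fun (indic (S i))) ->
  spread_fun (indic (\bigcup_(i in J) S i)).
Proof.
move=> SJ.
have sf := @spread_fun_sum _ (index_enum I) (mem J) (fun i => indic (S i)) SJ.
apply: (@spread_fun_lin 0 _ _ _ spread_fun_cst0 sf) => x.
by rewrite indic_bigcup mul0r add0r.
Qed.

Lemma card_disjoint_bigcup : #|\bigcup_(i in J) S i| = (\sum_(i in J) #|S i|)%N.
Proof.
apply/eqP; rewrite -(eqr_nat rat) -sum_indic natr_sum; apply/eqP.
rewrite (eq_bigr _ (fun x _ => indic_bigcup x)) exchange_big.
by apply: eq_bigr => i _; rewrite sum_indic.
Qed.

End DisjointUnion.

Hypothesis F2 : (2 : F) != 0.

(** Both sides of [latin_pair] are bilinear, so two inductions reduce it to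
    pairs of generators. *)
Lemma spread_fun_latin f g : spread_fun f -> spread_fun g -> latin_pair f g.
Proof.
move=> sf; elim=> [||t|a {}g h k _ fg _ fh kE]; last first.
- by apply/latin_pairC/(latin_pair_lin kE); apply/latin_pairC.
- elim: sf => [||s|a {}f h k _ fg _ fh kE]; last exact: (latin_pair_lin kE).
  + exact/latin_pair_punct/line0.
  + exact: latin_pair_chiQ_line.
  + exact: latin_pair_line.
- elim: sf => [||s|a {}f h k _ fg _ fh kE]; last exact: (latin_pair_lin kE).
  + exact/latin_pair_punct/(spread_fun0 spread_fun_chiQ).
  + exact: latin_pair_chiQ.
  + exact/latin_pairC/latin_pair_chiQ_line.
- exact/latin_pairC/latin_pair_punct/spread_fun0.
Qed.

End InvariantFunctions.

(** * The group *)

Section TheGroup.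

#[local] Set Implicit Arguments.
#[local] Unset Strict Implicit.
#[local] Unset Printing Implicit Defensive.
Import GroupScope GRing.Theory.
Local Open Scope ring_scope.

Variable F : finFieldType.
Notation V := 'rV[F]_4.
Implicit Types (x y : V) (a b : F) (g h : agl F).

Definition emb x : agl F := AGL (B (coordv x 2)) x.

Lemma emb_inj : injective emb.
Proof. by move=> x y [_ ->]. Qed.

Lemma BM a b : (B a * B b)%g = B (a + b).
Proof.
apply: val_inj; apply/row_matrixP => i; rewrite /= !rowE mulmxA !mulmx_Bmx !vec4E.
by apply: coordvP; rewrite !vec4E; ring.
Qed.

Lemma B0 : B (0 : F) = 1%g.
Proof. by apply: (mulgI (B 0)); rewrite BM addr0 mulg1. Qed.

Lemma emb0 : emb 0 = 1%g.
Proof. by rewrite /emb coordv0 B0. Qed.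

Lemma embM x y : (emb x * emb y)%g = emb (x *m Bmx (coordv y 2) + y).
Proof.
congr AGL => /=; rewrite BM; congr B.
by rewrite coordvD mulmx_Bmx vec4E.
Qed.

Lemma emb_div x y : (emb x * (emb y)^-1)%g = emb ((x - y) *m Bmx (- coordv y 2)).
Proof.
apply: (mulIg (emb y)); rewrite mulgKV embM -mulmxA.
rewrite [X in _ *m X](_ : _ = 1%:M) ?mulmx1 ?subrK //.
apply/row_matrixP => i; rewrite !rowE mulmxA !mulmx_Bmx !vec4E mulmx1.
by apply: coordvP; rewrite !vec4E; ring.
Qed.

Lemma emb_group_set : group_set [set emb x | x : V].
Proof.
apply/group_setP; split; first by apply/imsetP; exists 0; rewrite ?emb0.
by move=> _ _ /imsetP[x _ ->] /imsetP[y _ ->]; rewrite embM imset_f.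
Qed.

(** The elements [emb x] form a group, which contains the generators of [G]; the
    converse is the factorization of [emb x] into a translation by a vector of
    [U] and an element of [Bgrp]. *)
Lemma memG g : (g \in G F) = (g == emb (agl_vec g)).
Proof.
have [e1 e2 e3 e4] := coordv_e F.
have UE x : (x \in U F) = (coordv x 2 == 0) && (coordv x 3 == 0).
  have -> : U F = Usp None by rewrite /U /Usp /= !span_cons span_nil !addv0 addvC.
  rewrite mem_Usp /form1 /form2 /= !mul0r add0r sub0r !mul1r oppr_eq0 andbC.
  by [].
apply/idP/eqP => [|->].
  suff sub : G F \subset Group emb_group_set.
    by move=> /(subsetP sub) /imsetP[x xT gE]; rewrite gE.
  rewrite join_subG gen_subG; apply/andP; split; apply/subsetP => h.
    case/imsetP => u; rewrite UE => /andP[/eqP u2 _] ->.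
    by apply/imsetP; exists u; rewrite // /emb u2 B0.
  case/imsetP => -[a b] abT ->; apply/imsetP; exists (a *: e F 2 + b *: e F 3) => //.
  by rewrite /emb e2 e3 !(coordvE, vec4E) mulr1 mulr0 addr0.
set x := agl_vec g.
pose u := vec4 (coordv x 1 - coordv x 2 * coordv x 4) 0 0 (coordv x 4).
have -> : emb x = (AGL 1%g u * AGL (B (coordv x 2))
    (coordv x 2 *: e F 2 + coordv x 3 *: e F 3))%g.
  congr AGL => /=; first by rewrite mul1g.
  by rewrite mulmx_Bmx e2 e3; apply: coordvP; rewrite !(coordvE, vec4E); ring.
rewrite groupM //.
  apply: (subsetP (joing_subl _ _)); apply: imset_f.
  by rewrite UE /u !vec4E eqxx.
apply: (subsetP (joing_subr _ _)); apply: mem_gen.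
by apply/imsetP; exists (coordv x 2, coordv x 3).
Qed.
End TheGroup.

(** * Partial difference sets and schemes on the group *)

Section Transfer.

#[local] Set Implicit Arguments.
#[local] Unset Strict Implicit.
#[local] Unset Printing Implicit Defensive.
Import GroupScope Order.TTheory GRing.Theory Num.Theory.
Local Open Scope ring_scope.

Variable F : finFieldType.
Notation V := 'rV[F]_4.
Notation q := (#|F|%:R : rat).
Implicit Types (u w x y : V) (S : {set V}) (g h : agl F).

Definition lift_set S : {set agl F} := [set g in G F | agl_vec g \in S].

Lemma emb_G x : emb x \in G F. Proof. by rewrite memG. Qed.

Lemma mem_lift S x : (emb x \in lift_set S) = (x \in S).
Proof. by rewrite inE emb_G. Qed.

Lemma memGP g : g \in G F -> exists x, g = emb x.
Proof. by rewrite memG => /eqP gE; exists (agl_vec g). Qed.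

Lemma lift_setE S : lift_set S = [set emb x | x in S].
Proof.
apply/setP => g; apply/idP/imsetP => [|[x xS ->]]; last by rewrite mem_lift.
by move=> gS; have /setIdP[/memGP[x gE] _] := gS; exists x; rewrite // -mem_lift -gE.
Qed.

Lemma card_lift S : #|lift_set S| = #|S|.
Proof. by rewrite lift_setE card_imset //; apply: emb_inj. Qed.

Lemma cardG : #|G F| = (#|F| ^ 4)%N.
Proof.
have -> : #|G F| = #|lift_set setT|.
  by apply: eq_card => g; rewrite !inE andbT.
by rewrite card_lift cardsT card_mx mul1n.
Qed.

Lemma indic_eq S S' x y : indic S x = indic S' y -> (x \in S) = (y \in S').
Proof. by rewrite /indic; do 2!case: (_ \in _). Qed.

Lemma mem_Bmx S x a : spread_fun (indic S) -> (x *m Bmx a \in S) = (x \in S).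
Proof. by move=> sS; apply/indic_eq/spread_fun_Bmx. Qed.

Lemma memN S x : spread_fun (indic S) -> (- x \in S) = (x \in S).
Proof. by move=> sS; apply/indic_eq/spread_funN. Qed.

Lemma notin0 S : spread_fun (indic S) -> 0 \notin S.
Proof. by move=> /spread_fun0 /eqP; rewrite pnatr_eq0 eqb0. Qed.

Lemma mem_lift_div S x y : spread_fun (indic S) ->
  ((emb x * (emb y)^-1)%g \in lift_set S) = (x - y \in S).
Proof. by move=> sS; rewrite emb_div mem_lift mem_Bmx. Qed.

Lemma mem_liftV S x : spread_fun (indic S) ->
  ((emb x)^-1%g \in lift_set S) = (x \in S).
Proof.
by move=> sS; rewrite -[X in X \in _]mul1g -emb0 mem_lift_div // sub0r memN.
Qed.

Definition split_sum S S' u : {set V} := [set w | (w \in S) && (u - w \in S')].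

Lemma card_split_sum S S' u :
  #|split_sum S S' u|%:R = conv (indic S) (indic S') u.
Proof.
rewrite -sum1dep_card natr_sum /conv big_mkcond /=; apply: eq_bigr => w _.
by rewrite /indic; do 2!case: (_ \in _); rewrite ?mulr0 ?mul0r ?mulr1.
Qed.

(** As [lift_set S] is closed under inversion, a quotient [d1 * d2^-1] equal to
    [emb u] comes from the sum [u = (u - w) + w] with [emb w = d2^-1]. *)
Lemma num_diff_lift S u : spread_fun (indic S) ->
  num_diff (lift_set S) (emb u) = #|split_sum S S u|.
Proof.
move=> sS; pose f w := ((emb u * (emb w)^-1)%g, (emb w)^-1%g).
have f_inj : injective f 
  by move=> w w' ww; apply: emb_inj; apply: invg_inj; apply: (congr1 snd ww).
rewrite -(card_imset _ f_inj); apply: eq_card => -[d1 d2]; rewrite inE /=.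
apply/and3P/imsetP => [[d1S d2S /eqP dd]|[w]].
  have /setIdP[/groupVr/memGP[w d2w] _] := d2S.
  have d2E : d2 = (emb w)^-1%g by rewrite -d2w invgK.
  have d1E : d1 = (emb u * (emb w)^-1)%g by rewrite -dd -d2w mulgK.
  exists w; last by rewrite d1E d2E.
  by rewrite inE -mem_liftV // -d2E d2S -mem_lift_div // -d1E.
rewrite inE => /andP[wS uwS] [-> ->].
by rewrite mem_liftV // mem_lift_div // invgK mulgKV.
Qed.

Hypothesis F2 : (2 : F) != 0.

Lemma lrank_indic S r : #|S| = (r * (#|F| ^ 2 - 1))%N -> lrank (indic S) = r%:R.
Proof.
move=> cS; rewrite /lrank sum_indic.
rewrite cS natrM natrB ?expn_gt0 ?(ltnW (finNzRing_gt1 F)) // natrX.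
by rewrite mulfK // q2_neq1.
Qed.

(** For [f = g = indic S] the identity [latin_pair] reads
    [r ^ 2 - r + (q ^ 2 - 2 * r) * indic S u]: these are the two intersection
    numbers of Latin square type with [n = q ^ 2]. *)
Lemma latin_square_lift S r : spread_fun (indic S) ->
  #|S| = (r * (#|F| ^ 2 - 1))%N -> latin_square_pds (G F) (lift_set S).
Proof.
move=> sS cS; have q1 := finNzRing_gt1 F.
have lE : (#|F| ^ 2 + r ^ 2 - 3 * r + 3 * r = #|F| ^ 2 + r ^ 2)%N.
  rewrite subnK //; have : (3 * r <= 2 + r ^ 2)%N.
    by case: (r) => [|[|k]] //; rewrite -mulnn; nia.
  have : (2 ^ 2 <= #|F| ^ 2)%N by rewrite leq_exp2r.
  by lia.
exists (#|F| ^ 2)%N, r, (#|F| ^ 2 + r ^ 2 - 3 * r)%N; split => //.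
split; first split.
- by apply/subsetP => g /setIdP[].
- by rewrite cardG -expnM.
- by rewrite card_lift.
- by rewrite -emb0 mem_lift notin0.
- apply/setP => g; rewrite inE; apply/idP/idP => gS.
    have /setIdP[/groupVr/memGP[x gE] _] := gS.
    by move: gE gS; rewrite invgK => ->; rewrite mem_liftV // mem_lift.
  have /setIdP[/memGP[x gE] _] := gS.
  by move: gS; rewrite gE mem_liftV // mem_lift.
move=> g /setD1P[g1 /memGP[u gE]]; move: g1; rewrite {}gE => g1.
have u0 : u != 0 by apply: contraNneq g1 => ->; rewrite emb0.
rewrite num_diff_lift // mem_lift.
have := spread_fun_latin F2 sS sS u0.
rewrite -card_split_sum (lrank_indic cS).
rewrite (@eq_lrank _ (fun x => indic S x * indic S x) (indic S)) => [|x]; last first.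
  by rewrite -natrM mulnb andbb.
rewrite (lrank_indic cS) /indic; set N := #|split_sum S S u|.
case: (u \in S) => /= NE.
  apply/eqP; rewrite -(eqn_add2r (3 * r)) lE -(eqr_nat rat); apply/eqP.
  by rewrite !natrD NE natrM !natrX; ring.
apply/eqP; rewrite -(eqn_add2r r) subnK; last by nia.
by rewrite -(eqr_nat rat) natrD NE natrX; apply/eqP; ring.
Qed.

Definition vrel S : {set agl F * agl F} :=
  [set gh in setX (G F) (G F) | agl_vec gh.1 - agl_vec gh.2 \in S].

Lemma mem_vrel S x y : ((emb x, emb y) \in vrel S) = (x - y \in S).
Proof. by rewrite !inE !emb_G. Qed.

Lemma vrelP S gh : gh \in vrel S ->
  exists x y, gh = (emb x, emb y) /\ x - y \in S.
Proof.
case: gh => g h /[dup] gS /setIdP[/setXP[/memGP[x gE] /memGP[y hE]] _].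
by exists x, y; move: gS; rewrite gE hE mem_vrel.
Qed.

Lemma setXGP gh : gh \in setX (G F) (G F) -> exists x y, gh = (emb x, emb y).
Proof. by case: gh => g h /setXP[/memGP[x ->] /memGP[y ->]]; exists x, y. Qed.

Lemma eq_vrel S (R : {set agl F * agl F}) : R \subset setX (G F) (G F) ->
  (forall x y, ((emb x, emb y) \in R) = (x - y \in S)) -> R = vrel S.
Proof.
move=> sub RS; apply/setP => gh; apply/idP/idP => [/[dup] ghR|].
  by move=> /(subsetP sub)/setXGP[x [y ghE]]; move: ghR; rewrite ghE RS mem_vrel.
by case/vrelP => x [y [-> ]]; rewrite RS.
Qed.

Lemma group_rel_lift S : spread_fun (indic S) ->
  group_rel (G F) (lift_set S) = vrel S.
Proof.
move=> sS; apply: eq_vrel => [|x y]; first by apply/subsetP => gh /setIdP[].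
by rewrite inE mem_lift_div // inE !emb_G.
Qed.

Lemma diag_vrel : diag (G F) = vrel [set 0].
Proof.
apply: eq_vrel => [|x y].
  by apply/subsetP => _ /imsetP[g gG ->]; rewrite inE gG.
rewrite inE subr_eq0; apply/imsetP/eqP => [[g _ [<- /emb_inj]] //|->].
by exists (emb y); rewrite ?emb_G.
Qed.

Lemma card_vrel_path S S' x y :
  #|[set z in G F | ((emb x, z) \in vrel S) && ((z, emb y) \in vrel S')]|
    = #|split_sum S S' (x - y)|.
Proof.
have f_inj : injective (fun w => emb (x - w)) 
  by move=> w w' ww; apply: (subrI x); apply: emb_inj.
rewrite -(card_imset _ f_inj); apply: eq_card => z; rewrite inE.
apply/andP/imsetP => [[/memGP[c ->]]|[w]].
  rewrite !mem_vrel => /andP[xc cy]; exists (x - c); last by rewrite subKr.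
  by rewrite inE xc (_ : x - y - (x - c) = c - y) // opprB addrC addrA subrK.
rewrite inE => /andP[wS ywS] ->; rewrite emb_G !mem_vrel subKr wS.
by rewrite addrAC.
Qed.

Lemma transp_vrel S : (forall x, (- x \in S) = (x \in S)) ->
  transp (vrel S) = vrel S.
Proof.
move=> SN; apply: eq_vrel => [|x y].
  by apply/subsetP => _ /imsetP[gh /vrelP[x [y [-> _]]] ->]; rewrite inE !emb_G.
rewrite -opprB SN; apply/imsetP/idP => [[gh /vrelP[a [b [-> ab]]] xy]|xy].
  have -> : y = a by apply: emb_inj; apply: (congr1 snd xy).
  by have -> : x = b by apply: emb_inj; apply: (congr1 fst xy).
by exists (emb y, emb x); rewrite ?mem_vrel.
Qed.

(** These relations are closed under disjoint unions, so that the same criterion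
    applies to the scheme and to all of its fusions. *)
Definition spread_rel (R : {set agl F * agl F}) : Prop :=
  exists2 S, spread_fun (indic S) & R = vrel S.

Lemma partition_eq (T : finType) (P : {set {set T}}) (X A B : {set T}) (x : T) :
  partition P X -> A \in P -> B \in P -> x \in B -> (x \in A) = (A == B).
Proof.
case/and3P => _ tP _ AP BP xB; apply/idP/eqP => [xA|->//].
by rewrite -(def_pblock tP AP xA) (def_pblock tP BP xB).
Qed.

(** The number of paths in two relations of the scheme only depends on which
    relation joins the end points, because the right-hand side of [latin_pair]
    only involves the values of the two indicator functions there. *)
Lemma assoc_scheme_of_spread_rel t (P : {set {set agl F * agl F}}) :
  partition P (setX (G F) (G F)) -> diag (G F) \in P -> #|P| = t.+1 ->
  (forall R, R \in P -> R != diag (G F) -> spread_rel R) ->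
  assoc_scheme (G F) t P.
Proof.
move=> partP dP cP PS.
have PR R : R \in P -> R = diag (G F) \/ spread_rel R.
  by move=> RP; have [|nR] := eqVneq R (diag (G F)); [left|right; apply: PS].
have diagE x y : ((emb x, emb y) \in diag (G F)) = (x == y).
  by rewrite diag_vrel mem_vrel inE subr_eq0.
split=> //.
  move=> R RP; case: (PR R RP) => [RE|[S sS RE]].
    suff -> : transp R = R by [].
    by rewrite RE diag_vrel; apply: transp_vrel => x; rewrite !inE oppr_eq0.
  by rewrite {1}RE transp_vrel -?RE // => x; apply: memN.
move=> Ri Rj Rk iP jP kP.
suff [N NE] : exists N, forall x y, (emb x, emb y) \in Rk ->
    #|[set z in G F | ((emb x, z) \in Ri) && ((z, emb y) \in Rj)]| = N.
  exists N => g h /[dup] ghk /(subsetP (partitionS partP kP))/setXGP[x [y []]] gE hE.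
  by move: ghk; rewrite gE hE; apply: NE.
case: (PR Ri iP) => [iE|[Si sSi iE]].
  exists (Rj == Rk) => x y xyk; rewrite -(partition_eq partP jP kP xyk) iE.
  rewrite (_ : [set _ in _ | _] =
      if (emb x, emb y) \in Rj then [set emb x] else set0).
    by case: ifP; rewrite ?cards1 ?cards0.
  apply/setP => z; rewrite inE; apply/andP/idP => [[/memGP[c ->]]|].
    by rewrite diagE => /andP[/eqP -> ->]; rewrite inE.
  by case: ifP; rewrite inE // => xyj /eqP ->; rewrite emb_G diagE eqxx.
case: (PR Rj jP) => [jE|[Sj sSj jE]].
  exists (Ri == Rk) => x y xyk; rewrite -(partition_eq partP iP kP xyk) jE.
  rewrite (_ : [set _ in _ | _] =
      if (emb x, emb y) \in Ri then [set emb y] else set0).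
    by case: ifP; rewrite ?cards1 ?cards0.
  apply/setP => z; rewrite inE; apply/andP/idP => [[/memGP[c ->]]|].
    by rewrite diagE => /andP[xyi /eqP cy]; rewrite -cy xyi inE.
  by case: ifP; rewrite inE // => xyj /eqP ->; rewrite emb_G diagE eqxx andbT.
case: (PR Rk kP) => [kE|[Sk sSk kE]].
  exists #|split_sum Si Sj 0| => x y; rewrite kE diagE => /eqP ->.
  by rewrite iE jE card_vrel_path subrr.
have [->|/set0Pn[ab /[dup] abk]] := eqVneq Rk set0.
  by exists 0%N => x y; rewrite inE.
rewrite {1}kE => /vrelP[a [b [abE abS]]]; rewrite {}abE in abk.
exists #|split_sum Si Sj (a - b)| => x y xyk; rewrite iE jE card_vrel_path.
have nz x' y' : (emb x', emb y') \in Rk -> x' - y' != 0.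
  by rewrite kE mem_vrel => xyS; apply: contraTneq xyS => ->; apply: notin0.
have const R S : R \in P -> R = vrel S -> indic S (x - y) = indic S (a - b).
  move=> RP RE; congr (_ %:R); rewrite -!mem_vrel -RE.
  by rewrite (partition_eq partP RP kP xyk) (partition_eq partP RP kP abk).
apply/eqP; rewrite -(eqr_nat rat) !card_split_sum.
have lat := spread_fun_latin F2 sSi sSj.
rewrite (lat _ (nz _ _ xyk)) (lat _ (nz _ _ abk)).
by rewrite (const _ _ iP iE) (const _ _ jP jE).
Qed.
End Transfer.

(** * The scheme and its fusions *)

Section Classes.

#[local] Set Implicit Arguments.
#[local] Unset Strict Implicit.
#[local] Unset Printing Implicit Defensive.
Import GroupScope Order.TTheory GRing.Theory Num.Theory.
Local Open Scope ring_scope.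

Variable F : finFieldType.
Hypothesis F2 : (2 : F) != 0.
Notation V := 'rV[F]_4.
Notation q := (#|F|%:R : rat).
Implicit Types (x : V) (i j : nat).
Notation N := (#|F| + 3)%N.

Variable alpha : nat -> option F.
Hypothesis alpha_enum : forall a : option F,
  exists! i : nat, (3 <= i <= N)%N /\ alpha i = a.

Lemma alpha_inj i j : (3 <= i <= N)%N -> (3 <= j <= N)%N ->
  alpha i = alpha j -> i = j.
Proof.
move=> iN jN ij; have [k [_ kE]] := alpha_enum (alpha j).
by rewrite -(kE i) // -(kE j).
Qed.

(** The vector sets behind the [D alpha i]. Only the index 0 differs: here it
    stands for the diagonal relation, so that all relations form one family. *)
Definition cls i : {set V} :=
  match i with
  | 0 => [set 0]
  | 1 => [set x | (Q x != 0) && is_square (Q x)]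
  | 2 => [set x | ~~ is_square (Q x)]
  | _ => [set x | (x != 0) && (x \in Usp (alpha i))]
  end.

Lemma D_lift i : (0 < i)%N -> D alpha i = lift_set (cls i).
Proof. by case: i => [|[|[|i]]] // _; apply/setP => g; rewrite !inE. Qed.

Lemma is_square0 : is_square (0 : F).
Proof. by apply/existsP; exists 0; rewrite expr0n. Qed.

Lemma indic_cls_line i : (2 < i)%N -> indic (cls i) =1 line (alpha i).
Proof.
case: i => [|[|[|i]]] // _ x; rewrite /indic inE /=.
have [->|x0] := eqVneq x 0; first by rewrite line0.
by rewrite line_neq0.
Qed.

Lemma indic_cls1 x : indic (cls 1) x = 2^-1 * (chiQ x * chiQ x + chiQ x).
Proof.
rewrite /indic inE /= /chiQ /chi; have [->|_] := eqVneq (Q x) 0.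
  by rewrite /=; ring.
by case: (is_square _) => /=; field.
Qed.

Lemma indic_cls2 x : indic (cls 2) x = 2^-1 * (chiQ x * chiQ x - chiQ x).
Proof.
rewrite /indic inE /= /chiQ /chi; have [->|_] := eqVneq (Q x) 0.
  by rewrite is_square0 /=; ring.
by case: (is_square _) => /=; field.
Qed.

Lemma spread_fun_cls i : (0 < i)%N -> spread_fun (indic (cls i)).
Proof.
have scal (c : rat) f : spread_fun f -> spread_fun (fun x : V => c * f x).
  by move=> sf; apply: (spread_fun_lin sf (spread_fun_cst0 F)) => x; rewrite addr0.
have sq := scal 2^-1 _ (spread_fun_chiQ_sqr F).
case: i => [|[|[|i]]] // _.
- apply: (spread_fun_lin (a := 2^-1) (spread_fun_chiQ F) sq) => x.
  by rewrite indic_cls1; ring.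
- apply: (spread_fun_lin (a := - 2^-1) (spread_fun_chiQ F) sq) => x.
  by rewrite indic_cls2; ring.
have line_i := spread_fun_line (alpha i.+3).
apply: (spread_fun_lin (a := 1) line_i (spread_fun_cst0 F)) => x.
by rewrite addr0 mul1r indic_cls_line.
Qed.

Definition cls_rank i : nat := if (i <= 2)%N then 'C(#|F|, 2) else 1%N.

Lemma card_cls i : (0 < i)%N -> #|cls i| = (cls_rank i * (#|F| ^ 2 - 1))%N.
Proof.
move=> i0; have q1 := finNzRing_gt1 F.
have n1 : ((#|F| ^ 2 - 1)%N%:R : rat) = q ^+ 2 - 1.
  by rewrite natrB ?natrX // expn_gt0 ltnW.
have c2 : ('C(#|F|, 2)%:R : rat) = 2^-1 * (q ^+ 2 - q).
  have : (2 * 'C(#|F|, 2) = #|F| * (#|F| - 1))%N.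
    by rewrite -mul_bin_diag bin1 subn1.
  move=> /(congr1 (fun k : nat => k%:R : rat)).
  by rewrite !natrM natrB ?(ltnW q1) // => h; field: h.
apply/eqP; rewrite -(eqr_nat rat) -sum_indic natrM n1 /cls_rank.
case: i i0 => [|[|[|i]]] // _ /=.
- under eq_bigr => x _ do rewrite indic_cls1.
  by rewrite -mulr_sumr big_split /= sum_chiQ_sqr sum_chiQ // c2; apply/eqP; ring.
- under eq_bigr => x _ do rewrite indic_cls2.
  by rewrite -mulr_sumr sumrB /= sum_chiQ_sqr sum_chiQ // c2; apply/eqP; ring.
rewrite (eq_bigr _ (fun x _ => @indic_cls_line i.+3 isT x)).
by rewrite sum_line mul1r.
Qed.

Lemma cls_nonempty i : cls i != set0.
Proof.
case: i => [|i]; first by apply/set0Pn; exists 0; rewrite inE.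
have q1 := finNzRing_gt1 F.
rewrite -cards_eq0 card_cls // muln_eq0 negb_or /cls_rank subn_eq0 -ltnNge.
rewrite -[1%N]/(1 ^ 2)%N ltn_exp2r // q1 andbT -lt0n.
by case: ifP; rewrite ?bin_gt0.
Qed.

Lemma cls_disjoint i j x : (i < j <= N)%N -> x \in cls i -> x \in cls j -> False.
Proof.
case/andP => ij jN.
have lineQ k y : y \in cls k.+3 -> [/\ y != 0, y \in Usp (alpha k.+3) & Q y = 0].
  by rewrite inE => /andP[y0 yU]; split=> //; apply: Q_Usp yU.
case: j ij jN => // j ij jN.
case: i ij => [|[|[|i]]] ij.
- rewrite inE => /eqP -> x0.
  by have := notin0 (spread_fun_cls (ltn0Sn j)); rewrite x0.
- case: j ij jN => [|[|j]] // _ _; rewrite inE => /andP[x0 xs].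
    by rewrite inE xs.
  by case/lineQ => _ _ xQ; rewrite xQ eqxx in x0.
- case: j ij jN => [|[|j]] // _ _; rewrite inE => xs.
  by case/lineQ => _ _ xQ; rewrite xQ is_square0 in xs.
case: j ij jN => [|[|j]] // ij jN /lineQ[x0 xi _] /lineQ[_ xj _].
have aij : alpha i.+3 != alpha j.+3.
  apply/eqP => /alpha_inj; rewrite jN (leq_trans (ltnW ij) jN) => /(_ isT isT) ijE.
  by rewrite ijE ltnn in ij.
by rewrite (Usp_cap aij xi xj) eqxx in x0.
Qed.

Lemma cls_disjoint_neq i j : (i <= N)%N -> (j <= N)%N -> i != j ->
  [disjoint cls i & cls j].
Proof.
move=> iN jN; rewrite neq_ltn disjoint_subset => /orP[] ij;
  apply/subsetP => x xi; rewrite inE; apply/negP => xj.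
  by apply: (@cls_disjoint i j x); rewrite ?ij.
by apply: (@cls_disjoint j i x); rewrite ?ij.
Qed.

Lemma cls_cover x : exists2 i, (i <= N)%N & x \in cls i.
Proof.
have [->|x0] := eqVneq x 0; first by exists 0%N; rewrite ?inE.
have [Qx|Qx] := eqVneq (Q x) 0.
  have [t xt] := singular_Usp Qx.
  have [i [[/andP[i3 iN] ia] _]] := alpha_enum t; exists i => //.
  by case: i i3 ia {iN} => [|[|[|i]]] // _ ia; rewrite inE x0 ia.
case: (boolP (is_square (Q x))) => sx.
  by exists 1%N; rewrite ?inE ?Qx //; lia.
by exists 2%N; rewrite ?inE //; lia.
Qed.

Notation I := 'I_N.+1.
Definition cls_rel (i : I) := vrel (cls i).
Notation P := (cls_rel @: [set: I]).

Lemma cls_disjointI (J : {set I}) : {in J &, forall i j : I, j != i ->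
  [disjoint cls i & cls j]}.
Proof.
by move=> i j _ _ ij; apply: cls_disjoint_neq; rewrite -1?ltnS // eq_sym.
Qed.

Lemma ord_gt0 (J : {set I}) (i : I) : ord0 \notin J -> i \in J -> (0 < i)%N.
Proof.
move=> J0 iJ; rewrite lt0n; apply: contraNneq J0 => i0.
by rewrite -(_ : i = ord0) //; apply: val_inj.
Qed.

Lemma spread_fun_clsU (J : {set I}) : ord0 \notin J ->
  spread_fun (indic (\bigcup_(i in J) cls i)).
Proof.
move=> J0; apply: spread_fun_bigcup => [|i iJ]; first exact: cls_disjointI.
exact/spread_fun_cls/(ord_gt0 J0 iJ).
Qed.

Lemma latin_square_unionD (J : {set I}) : ord0 \notin J ->
  latin_square_pds (G F) (\bigcup_(i in J) D alpha i).
Proof.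
move=> J0; have Jgt0 (i : I) : i \in J -> (0 < i)%N := ord_gt0 J0.
have -> : \bigcup_(i in J) D alpha i = lift_set (\bigcup_(i in J) cls i).
  rewrite (eq_bigr (fun i : I => lift_set (cls i))) => [|i /Jgt0/D_lift //].
  apply/setP => g; rewrite inE; apply/bigcupP/andP => [[i iJ]|[gG /bigcupP[i iJ gi]]].
    by rewrite inE => /andP[gG gi]; split=> //; apply/bigcupP; exists i.
  by exists i; rewrite // inE gG.
apply: (latin_square_lift F2 (r := \sum_(i in J) cls_rank i)).
  exact: spread_fun_clsU.
rewrite card_disjoint_bigcup; last exact: cls_disjointI.
by rewrite big_distrl; apply: eq_bigr => i /Jgt0/card_cls.
Qed.

Lemma cls_rel0 : cls_rel ord0 = diag (G F).
Proof. by rewrite diag_vrel. Qed.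

Lemma relD :
  diag (G F) |: [set group_rel (G F) (D alpha i) | i : I & (0 < i)%N] = P.
Proof.
have relE (i : I) : (0 < i)%N -> group_rel (G F) (D alpha i) = cls_rel i.
  by move=> i0; rewrite D_lift // group_rel_lift //; apply: spread_fun_cls.
apply/setP => R; rewrite !inE; apply/orP/imsetP => [[/eqP ->|/imsetP[i]]|[i iI ->]].
- by exists ord0; rewrite ?cls_rel0.
- by rewrite inE => i0 ->; exists i; rewrite ?relE.
have [i0|i0] := posnP i.
  by left; rewrite -cls_rel0 (_ : i = ord0) //; apply: val_inj.
by right; apply/imsetP; exists i; rewrite ?inE ?relE.
Qed.

Lemma vrel_disjoint (S S' : {set V}) : [disjoint S & S'] ->
  [disjoint vrel S & vrel S'].
Proof.
rewrite !disjoint_subset => /subsetP SS'.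
apply/subsetP => gh /vrelP[x [y [-> xy]]].
by rewrite !inE !emb_G /=; apply: SS'.
Qed.

Lemma cls_rel_partition : partition P (setX (G F) (G F)) /\ injective cls_rel.
Proof.
have n0 : set0 \notin P.
  apply/imsetP => -[i _ i0]; have /set0Pn[x xi] := cls_nonempty i.
  have : (emb x, emb 0) \in cls_rel i by rewrite mem_vrel subr0.
  by rewrite -i0 inE.
have dis : {in [set: I] &, forall i j : I, j != i ->
    [disjoint cls_rel i & cls_rel j]}.
  by move=> i j iI jI ij; apply/vrel_disjoint/(cls_disjointI iI jI).
have [tP inj] := trivIimset dis n0; split; last first.
  by move=> i j; apply: inj; rewrite inE.
rewrite /partition [trivIset _]tP n0 !andbT cover_imset; apply/eqP/setP => gh.
apply/bigcupP/idP => [[i _ /setIdP[]]//|/setXGP[x [y ->]]].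
have [i iN xyi] := cls_cover (x - y).
by exists (inord i); rewrite // mem_vrel inordK.
Qed.

(** A block of the fusion comes from the union of the classes it merges. *)
Lemma fusion_spread_rel (S : {set {set {set agl F * agl F}}}) R :
  partition S (P :\ diag (G F)) -> R \in fusion (G F) S -> R != diag (G F) ->
  spread_rel R.
Proof.
move=> partS; rewrite !inE => /orP[/eqP -> /eqP//|/imsetP[C CS ->] _].
have CP := subsetP (partitionS partS CS).
pose J := [set i : I | cls_rel i \in C].
have J0 : ord0 \notin J.
  by rewrite inE; apply/negP => /CP; rewrite cls_rel0 !inE eqxx.
exists (\bigcup_(i in J) cls i); first exact: spread_fun_clsU.
apply: eq_vrel => [|x y].
  apply/bigcupsP => A /CP /setD1P[_ /imsetP[i _ ->]].
  by apply/subsetP => gh /setIdP[].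
apply/bigcupP/bigcupP => [[A AC]|[i]].
  have /setD1P[_ /imsetP[i _ AE]] := CP A AC; rewrite AE mem_vrel => xyi.
  by exists i; rewrite // inE -AE.
by rewrite inE => iC xyi; exists (cls_rel i); rewrite // mem_vrel.
Qed.

Lemma fusion_partition (S : {set {set {set agl F * agl F}}}) :
  partition S (P :\ diag (G F)) ->
  partition (fusion (G F) S) (setX (G F) (G F)) /\ #|fusion (G F) S| = #|S|.+1.
Proof.
move=> partS; have [partP _] := cls_rel_partition.
have dP : diag (G F) \in P by apply/imsetP; exists ord0; rewrite ?cls_rel0.
have fusE : fusion (G F) S = cover @: ([set diag (G F)] |: S).
  by rewrite imsetU1 cover1.
have part1 : partition ([set diag (G F)] |: S) P.
  rewrite -(setD1K dP); apply: partitionU1 => //.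
    by apply/set0Pn; exists (diag (G F)); rewrite inE.
  by rewrite disjoints1 !inE eqxx.
have [partF inj] := partition_partition partP part1.
rewrite fusE; split => //; rewrite card_in_imset // cardsU1.
suff -> : [set diag (G F)] \notin S by [].
apply/negP => dS; have /subsetP/(_ (diag (G F))) := partitionS partS dS.
by rewrite !inE !eqxx => /(_ isT).
Qed.

Lemma amorphic_cls_rel : amorphic_scheme (G F) N P.
Proof.
have [partP inj] := cls_rel_partition; split.
  apply: (assoc_scheme_of_spread_rel F2) => //.
  - by apply/imsetP; exists ord0; rewrite ?cls_rel0.
  - by rewrite card_imset // cardsT card_ord.
  move=> R /imsetP[i _ ->] iD; exists (cls i) => //.
  apply: spread_fun_cls; rewrite lt0n; apply: contraNneq iD => i0.
  by rewrite -cls_rel0 (_ : i = ord0) //; apply: val_inj.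
move=> S partS; have [partF cF] := fusion_partition partS.
apply: (assoc_scheme_of_spread_rel F2) => //; first by rewrite !inE eqxx.
by move=> R RF RD; apply: fusion_spread_rel RF RD.
Qed.

Lemma latin_square_D i : (0 < i <= N)%N -> latin_square_pds (G F) (D alpha i).
Proof.
case/andP => i0 iN; rewrite D_lift //.
by apply: (latin_square_lift F2) (card_cls i0); apply: spread_fun_cls.
Qed.

End Classes.

Lemma odd_card_two_neq0 (p m : nat) (F : finFieldType) :
  prime p -> odd p -> #|F| = p ^ m -> (2%:R != 0 :> F)%R.
Proof.
move=> p_prime p_odd cF; have pF := card_finPcharP cF p_prime.
rewrite -(GRing.dvdn_pcharf pF); apply/negP => /(dvdn_leq (ltn0Sn 1)) p2.
by rewrite (_ : p = 2) // in p_odd; apply/eqP; rewrite eqn_leq p2 prime_gt1.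
Qed.

Theorem theorem3p12 (p m q : nat) (p_prime : prime p) (p_odd : odd p)
    (m_gt0 : 0 < m) (q_def : q = p ^ m)
    (F : finFieldType) (cardF : #|F| = q)
    (alpha : nat -> option F)
    (alpha_enum : forall a : option F,
       exists! i : nat, 3 <= i <= q + 3 /\ alpha i = a) :
  [/\ #|G F| = q ^ 4,
      forall i : nat, 1 <= i <= q + 3 -> latin_square_pds (G F) (D alpha i),
      amorphic_scheme (G F) (q + 3)
        (diag (G F) |:
           [set group_rel (G F) (D alpha i) | i : 'I_(q + 3).+1 & 0 < i]) &
      forall J : {set 'I_(q + 3).+1}, ord0 \notin J ->
        latin_square_pds (G F) (\bigcup_(i in J) D alpha i)].
Proof.
have F2 : (2%:R != 0 :> F)%R.
  by apply: (odd_card_two_neq0 p m); rewrite ?cardF.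
clear q_def; subst q; split.
- exact: cardG.
- exact: latin_square_D.
- by rewrite relD //; apply: amorphic_cls_rel.
- exact: latin_square_unionD.
Qed.
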